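(* Let $k,\Delta\in\mathbb{N}$ and $d,\alpha,C'>0$. Then there exists a constant $C>0$ such that the following holds for all sufficiently large $n$. Let $G$ be an $n$-vertex $(d,\alpha)$-degenerate $k$-uniform hypergraph (with associated constant $\varepsilon$) with $\Delta(G)\le\Delta$, and let $H$ be an $n$-vertex $k$-uniform hypergraph. If there is a $(C'/n)$-vertex spread distribution $\mu$ on embeddings $\psi:G\to H$, then there exists a $(C/n^{1/d};r_0,\dots,r_l)$-spread distribution $\mu'$ on the copies of $G$ in $H$ (for some positive integer $l$), where $r_0=dn$, $r_1=\varepsilon n/k$, $r_i=r_{i-1}/n^{9\alpha/(10d)}$ for $2\le i\le l-1$, and $r_l=1$. In particular, ${\rm th}(G)\le n^{-1/d}$, i.e. for a sequence of such $G=G_n$ (with fixed $k,\Delta,d,\alpha,\varepsilon$), if $p\,n^{1/d}\to\infty$ then w.h.p. $G^{(k)}(n,p)$ contains a copy of $G$.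
   Context: $m_1(G)=\max\{e(F)/(v(F)-1): F\subseteq G,\ v(F)>1\}$. An $n$-vertex $k$-uniform hypergraph $G$ on $V$ is $(d,\alpha)$-degenerate if $m_1(G)\le d$ and there is a constant $0<\varepsilon<1$ such that every $U\subseteq V$ with $2\le|U|\le\varepsilon n$ satisfies $e(G[U])\le d(|U|-1)-\alpha$. A hypergraph embedding $\psi:G\to H$ is an injective map $V(G)\to V(H)$ mapping edges of $G$ to edges of $H$. A probability distribution $\mu$ on injections $\psi:X\to Y$ is $q$-vertex spread if for every $s\le|X|$ and all distinct $x_1,\dots,x_s\in X$ and distinct $y_1,\dots,y_s\in Y$, $\mu(\{\psi(x_i)=y_i\ \forall i\in[s]\})\le q^s$. ''Copies of $G$ in $H$'' means the hypergraph $\mathcal{H}$ with vertex set $E(H)$ whose edges are the edge sets of subgraphs of $H$ isomorphic to $G$. For $q\in[0,1]$ and a decreasing sequence $r_0>r_1>\dots>r_l$, with $\mathcal{H}$ an $r_0$-bounded hypergraph (all edges of size at most $r_0$) on vertex set $V$, a probability measure $\mu$ on $E(\mathcal{H})$ is $(q;r_0,\dots,r_l)$-spread if for every $i\in[l]$, every $t\in[r_i,r_{i-1}]$, and every set $S$ that is a $j$-element subset of some edge $A\in E(\mathcal{H})$ with $j\in[r_i,r_{i-1}]$, we have $\mu(\{A\in E(\mathcal{H}): |A\cap S|\ge t\})\le q^t$. $G^{(k)}(n,p)$ is the binomial random $k$-uniform hypergraph; ${\rm th}$ denotes a threshold function for containing a copy, up to constant factors.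
   Formalization: k is taken to be at least 2 (for k=0, r_1 is undefined; for k=1 the claim fails when G=H is all n singletons), and the spread part assumes ε/k<d, i.e. r_1<r_0, which is automatic unless G has no edges. *)

(* Defs.v *)
From mathcomp Require Import all_boot all_order all_algebra.
From mathcomp Require Import reals topology normedtype sequences exp.

Set Implicit Arguments.
Unset Strict Implicit.
Unset Printing Implicit Defensive.

Import Order.TTheory GRing.Theory Num.Theory.
Import numFieldNormedType.Exports.

Local Open Scope ring_scope.

(* A hypergraph with vertex set the whole finite type V is given by its edge
   set G : {set {set V}}.  A subgraph is a pair (vertex set, edge set), so that
   it may have isolated vertices and need not be spanning. *)

Section Hypergraphs.

Implicit Types V W : finType.

Definition uniform V (k : nat) (G : {set {set V}}) : bool :=
  [forall e in G, #|e| == k].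

Definition max_degree V (G : {set {set V}}) : nat :=
  (\max_(v : V) #|[set e in G | v \in e]|)%N.

Definition subgraph V (F : {set V} * {set {set V}}) (G : {set {set V}}) : bool :=
  (F.2 \subset G) && [forall e in F.2, e \subset F.1].

Definition induced V (G : {set {set V}}) (U : {set V}) : {set {set V}} :=
  [set e in G | e \subset U].

Definition embedding V W (G : {set {set V}}) (H : {set {set W}})
    (psi : {ffun V -> W}) : bool :=
  injectiveb psi && [forall e in G, psi @: e \in H].

Definition isomorphic V W (G : {set {set V}}) (F : {set W} * {set {set W}}) : bool :=
  [exists psi : {ffun V -> W},
    [&& injectiveb psi, psi @: [set: V] == F.1
      & [set psi @: e | e : {set V} in G] == F.2]].

(* The copies of G in H form a hypergraph on E(H): its edges are the edge sets
   A of the subgraphs (U, A) of H isomorphic to G. *)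
Definition copies V W (G : {set {set V}}) (H : {set {set W}}) :
    {set {set {set W}}} :=
  [set A | [exists U : {set W}, subgraph (U, A) H && isomorphic G (U, A)]].

End Hypergraphs.

Section Spread.

Variable R : realType.
Implicit Types V W T : finType.

(* All the ratios are nonnegative, so the base value 0 of the maximum only
   matters when there is no F with v(F) > 1. *)
Definition m1 V (G : {set {set V}}) : R :=
  \big[Num.max/0]_(F : {set V} * {set {set V}} | subgraph F G && (1 < #|F.1|)%N)
    (#|F.2|%:R / (#|F.1|%:R - 1)).

(* eps is a parameter: for a single finite G its existence would be void, since
   eps * n < 2 makes the condition on the sets U empty. *)
Definition degenerate V (d alpha eps : R) (G : {set {set V}}) : Prop :=
  [/\ 0 < eps < 1, m1 G <= d
    & forall U : {set V}, (2 <= #|U|)%N -> #|U|%:R <= eps * #|V|%:R ->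
        #|induced G U|%:R <= d * (#|U|%:R - 1) - alpha].

Definition distribution T (mu : T -> R) : Prop :=
  (forall x, 0 <= mu x) /\ \sum_x mu x = 1.

Definition supported T (mu : T -> R) (P : pred T) : Prop :=
  forall x, mu x != 0 -> P x.

Definition prob T (mu : T -> R) (P : pred T) : R := \sum_(x | P x) mu x.

Definition vertex_spread V W (q : R) (mu : {ffun V -> W} -> R) : Prop :=
  [/\ distribution mu, supported mu (fun psi => injectiveb psi)
    & forall (s : nat) (x : s.-tuple V) (y : s.-tuple W),
        (s <= #|V|)%N -> uniq x -> uniq y ->
        prob mu [pred psi : {ffun V -> W} |
                  [forall i : 'I_s, psi (tnth x i) == tnth y i]] <= q ^+ s].

(* Only the values r 0, ..., r l are used. *)
Definition spread T (q : R) (l : nat) (r : nat -> R)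
    (HH : {set {set T}}) (mu : {set T} -> R) : Prop :=
  [/\ 0 <= q <= 1,
      forall i, (i < l)%N -> r i.+1 < r i,
      forall A, A \in HH -> #|A|%:R <= r 0%N,
      distribution mu /\ supported mu (fun A => A \in HH)
    & forall i, (1 <= i <= l)%N ->
      forall t : R, r i <= t <= r i.-1 ->
      forall A S : {set T}, A \in HH -> S \subset A ->
        r i <= #|S|%:R <= r i.-1 ->
        prob mu [pred B : {set T} | t <= #|B :&: S|%:R] <= q `^ t].

(* The probability mass function of G^(k)(n, p), with vertex set 'I_n. *)
Definition random_hypergraph (k n : nat) (p : R) (E : {set {set 'I_n}}) : R :=
  if uniform k E then p ^+ #|E| * (1 - p) ^+ ('C(n, k) - #|E|) else 0.

End Spread.

(* If G has an edge then the first two terms d * n and eps * n / k of the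
   spread sequence are in decreasing order. *)
Lemma degenerate_ltr_d (R : realType) (V : finType) (k : nat) (d alpha eps : R)
    (G : {set {set V}}) :
  (2 <= k)%N -> uniform k G -> degenerate d alpha eps G -> G != set0 ->
  eps / k%:R < d.
Proof.
move=> k2 /forall_inP uG [/andP[e0 e1] m1d _] /set0Pn[e eG].
have ek : #|e| = k by apply/eqP/uG.
have k0 : 0 < k%:R :> R by rewrite ltr0n; apply: leq_trans k2.
have k1 : 0 < k%:R - 1 :> R by rewrite subr_gt0 ltr1n.
apply: (@lt_le_trans _ _ (1 / (k%:R - 1))).
  apply: (@lt_trans _ _ (1 / k%:R)); first by rewrite ltr_pM2r ?invr_gt0.
  by rewrite !div1r ltf_pV2 ?posrE // ltrBlDr ltrDl.
apply: le_trans m1d; rewrite /m1.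
have := @le_bigmax_cond _ R _ 0 (e, [set e])
  (fun F : {set V} * {set {set V}} => subgraph F G && (1 < #|F.1|)%N)
  (fun F => #|F.2|%:R / (#|F.1|%:R - 1)).
rewrite /= cards1 ek; apply; rewrite k2 andbT /subgraph /= sub1set eG /=.
by apply/forall_inP => f /set1P->.
Qed.

(* Main.v *)
(* Spread.  Fix a copy psi0(G) and a set S of edges of G.  If the random copy
   psi(G) meets psi0(S) in t edges, then some F in S with t edges, together with
   a map phi from the vertices of F to V preserving edges, satisfies
   psi o phi = psi0 on the vertices of F.  If F has v vertices and c components,
   then as G has bounded degree there are at most O(1)^t n^c maps phi, each of
   which has probability at most (C'/n)^v.  Summing over the components, the
   density hypotheses give t <= d (v - c) - alpha (c - L), where L is the number
   of components with more than eps n vertices, so F contributes at most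
   O(1)^t n^(-t/d) n^(-alpha c/d) n^(alpha L/d), and L is at most 1/eps.  The
   number of sets F with t edges and given component representatives is O(1)^t,
   hence summing n^(-alpha c/d) over F costs (1 + n^(-alpha/d))^|S|, which is
   O(1)^t as soon as |S| <= t n^(alpha/d).

   Threshold.  The random hypergraph is exposed in l rounds.  Given a random set
   W of edges and a copy A, consider a minimal set B \ W, where B is a copy inside
   A u W.  Given the union Z of W and this fragment T, the fragment is a subset of
   any fixed copy inside Z, so the spread condition bounds the probability that
   |T| is large, and one round takes the sizes from r_i to r_(i+1).  After l
   rounds the fragments are empty; l is bounded in terms of alpha and d. *)

Require Import Defs.
From mathcomp Require Import all_boot all_order all_algebra.
From mathcomp Require Import perm ring lra.
From mathcomp Require Import reals topology normedtype sequences exp.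

Set Implicit Arguments.
Unset Strict Implicit.
Unset Printing Implicit Defensive.

Import Order.TTheory GRing.Theory Num.Theory.
Import numFieldNormedType.Exports.

Local Open Scope classical_set_scope.
Local Open Scope ring_scope.

(** * Clusters of bounded-degree relations *)

Section Clusters.

Variables (T : finType) (adj : rel T).
Hypothesis adjC : symmetric adj.
Implicit Types (F Q S Y : {set T}).

Definition cluster_rel F : rel T := [rel e f | [&& e \in F, f \in F & adj e f]].

(** Clusters are the connected components of [F] under [adj]; [fingraph.root] names each of them by
    a canonical element. *)
Definition cluster_root F (e : T) : T := fingraph.root (cluster_rel F) e.

Definition cluster_roots F : {set T} := [set cluster_root F e | e in F].

Definition cluster_of F (q : T) : {set T} := [set f in F | cluster_root F f == q].

Lemma cluster_connect_sym F : connect_sym (cluster_rel F).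
Proof. by apply: sym_connect_sym => e f; rewrite /cluster_rel /= adjC andbCA. Qed.

Lemma cluster_rel_closed F : fingraph.closed (cluster_rel F) (mem F).
Proof. by move=> e f /and3P[/= -> ->]. Qed.

Lemma cluster_root_in F e : (cluster_root F e \in F) = (e \in F).
Proof. exact/esym/(closed_connect (@cluster_rel_closed F))/connect_root. Qed.

Lemma cluster_roots_sub F : cluster_roots F \subset F.
Proof. by apply/subsetP => _ /imsetP[e eF ->]; rewrite cluster_root_in. Qed.

Lemma cluster_root_adj F e f :
  e \in F -> f \in F -> adj e f -> cluster_root F e = cluster_root F f.
Proof.
move=> eF fF ef; apply/eqP; rewrite (root_connect (cluster_connect_sym F)).
by apply: connect1; rewrite /cluster_rel /= eF fF.
Qed.

Lemma sum_card_cluster F : (\sum_(q in cluster_roots F) #|cluster_of F q|)%N = #|F|.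
Proof.
rewrite -[RHS]sum1_card.
rewrite [RHS](partition_big (cluster_root F) (mem (cluster_roots F))) /=; last first.
  by move=> f fF; apply: imset_f.
by apply: eq_bigr => q _; rewrite -sum1_card; apply: eq_bigl => f; rewrite inE.
Qed.

Variables (S : {set T}) (D : nat).
Hypothesis adj_refl : {in S, reflexive adj}.
Hypothesis adj_deg : {in S, forall e, #|[set f in S | adj e f]| <= D}%N.

(* [F] and a subset [Y] of [S] without neighbours in [F] can be recovered from
   [F :|: Y]: [F] is the union of the clusters of [F :|: Y] that meet [Q]. *)
Lemma card_cluster_roots_eq Q t :
  (#|[set F : {set T} | [&& F \subset S, #|F| == t & cluster_roots F == Q]]|
   <= 2 ^ (D * t))%N.
Proof.
set FF := [set F : {set T} | _].
pose N F := \bigcup_(e in F) [set f in S | adj e f].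
have FN F : F \subset S -> F \subset N F.
  move=> FS; apply/subsetP => e eF; apply/bigcupP; exists e => //.
  by rewrite inE adj_refl (subsetP FS).
have NS F : N F \subset S.
  by apply/bigcupsP => e _; apply/subsetP => f; rewrite inE => /andP[].
have cardN F : F \in FF -> (#|N F| <= D * t)%N.
  rewrite inE => /and3P[FS /eqP <- _].
  apply: (@leq_trans (\sum_(e in F) #|[set f in S | adj e f]|)%N).
    rewrite /N; elim/big_rec2: _ => [|e m U eF IH]; first by rewrite cards0.
    by apply: leq_trans (leq_card_setU _ _) _; rewrite leq_add2l.
  rewrite mulnC -sum_nat_const; apply: leq_sum => e eF.
  by apply: adj_deg; apply: (subsetP FS).
pose P := [set FY : {set T} * {set T} |
            (FY.1 \in FF) && (FY.2 \subset S :\: N FY.1)].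
have sub_rec F1 Y1 F2 Y2 : (F1, Y1) \in P -> (F2, Y2) \in P ->
    F1 :|: Y1 = F2 :|: Y2 -> F1 \subset F2.
  rewrite !inE /= => /andP[/and3P[F1S _ /eqP F1Q] Y1S].
  move=> /andP[/and3P[F2S _ /eqP F2Q] Y2S] U12; apply/subsetP => e eF1.
  have : cluster_root F1 e \in F2.
    have : cluster_root F1 e \in cluster_roots F1 by apply: imset_f.
    by rewrite F1Q -F2Q; apply: (subsetP (cluster_roots_sub F2)).
  (* A neighbour in [F1] of an element of [F2] lies in [F2 :|: Y2] but not in [Y2], which avoids
     [N F2]. So a cluster of [F1] with its root in [F2] stays inside [F2]. *)
  have cl : fingraph.closed (cluster_rel F1) (mem F2).
    have half x y : x \in F1 -> y \in F1 -> adj x y -> x \in F2 -> y \in F2.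
      move=> xF1 yF1 xy xF2.
      have : y \in F2 :|: Y2 by rewrite -U12 inE yF1.
      rewrite inE => /orP[//|/(subsetP Y2S)]; rewrite inE => /andP[/negP yN _].
      case: yN; apply/bigcupP; exists x => //.
      by rewrite inE xy (subsetP F1S).
    move=> x y /and3P[xF1 yF1 xy]; apply/idP/idP; apply: half => //.
    by rewrite adjC.
  by have /= -> := closed_connect cl (connect_root (cluster_rel F1) e).
have PI : {in P &, injective (fun FY => FY.1 :|: FY.2)}.
  move=> [F1 Y1] [F2 Y2] P1 P2 /= U12.
  have F12 : F1 = F2.
    apply/eqP; rewrite eqEsubset (sub_rec _ _ _ _ P1 P2 U12) /=.
    exact: (sub_rec _ _ _ _ P2 P1 (esym U12)).
  congr (_, _) => //; move: P1 P2 U12; rewrite !inE F12 /= => /andP[FF2 Y1S] /andP[_ Y2S].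
  have dis Y : Y \subset S :\: N F2 -> [disjoint Y & F2].
    move=> YS; apply: disjointWl YS _; rewrite disjoint_sym.
    apply: disjointWl (FN F2 _) _; first by case/and3P: FF2.
    by rewrite disjoint_sym -setI_eq0 setIDAC setD_eq0 subsetIr.
  move=> /(congr1 (fun U => U :\: F2)); rewrite !setDUl setDv !set0U.
  by rewrite !(setDidPl _) ?dis.
have cardP : #|P| = (\sum_(F in FF) 2 ^ #|S :\: N F|)%N.
  rewrite -sum1_card [LHS](partition_big (fun FY => FY.1) (mem FF)) /=; last first.
    by move=> FY; rewrite /P in_set => /andP[].
  apply: eq_bigr => F FFF; rewrite sum1_card -card_powerset.
  rewrite -[RHS](card_imset _ (_ : injective (fun Y => (F, Y)))); last by move=> ? ? [].
  apply: eq_card => -[F' Y]; rewrite [LHS]unfold_in /= /P in_set; apply/andP/imsetP.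
    by move=> [/andP[_ YS] /eqP FE]; rewrite FE in YS *; exists Y => //; rewrite powersetE.
  by move=> [Z]; rewrite powersetE => ZS [-> ->]; move: FFF; rewrite inE => ->.
have PS : (#|P| <= 2 ^ #|S|)%N.
  rewrite -card_powerset -(card_in_imset PI); apply: subset_leq_card.
  apply/subsetP => _ /imsetP[[F Y] + ->]; rewrite !inE /= => /andP[/and3P[FS _ _] YS].
  by rewrite subUset FS (subset_trans YS) // subsetDl.
(* Double counting: each [F] accounts for at least 2^(|S| - D t) pairs of [P], and there are at most
   2^|S| pairs in all. *)
rewrite -(leq_pmul2r (_ : 0 < 2 ^ #|S|)%N) ?expn_gt0 //.
apply: (@leq_trans (2 ^ (D * t) * #|P|)%N); last by rewrite leq_mul2l PS orbT.
rewrite cardP big_distrr /= -sum_nat_const; apply: leq_sum => F FFF.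
rewrite -expnD leq_exp2l // -(cardsID (N F) S) (setIidPr (NS F)).
by rewrite leq_add2r cardN.
Qed.

(** Grouped by their roots [Q], the sets fall into groups of at most 2^(D t), and the sum of x^|Q|
    over all [Q] in [S] is (1 + x)^|S|. *)
Lemma sum_expr_cluster_roots (R : realDomainType) (x : R) t : 0 <= x ->
  \sum_(F : {set T} | (F \subset S) && (#|F| == t)) x ^+ #|cluster_roots F|
  <= 2 ^+ (D * t) * (1 + x) ^+ #|S|.
Proof.
move=> x0.
rewrite [leLHS](partition_big cluster_roots [pred Q : {set T} | Q \subset S]) /=;
  last first.
  by move=> F /andP[FS _]; apply: subset_trans (cluster_roots_sub F) FS.
have -> : (1 + x) ^+ #|S| = \sum_(Q : {set T} | Q \subset S) x ^+ #|Q|.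
  have -> : (1 + x) ^+ #|S| = \prod_e ((if e \in S then x else 0) + 1).
    rewrite -prodr_const big_mkcond /=; apply: eq_bigr => e _.
    by case: ifP => _; rewrite ?add0r // addrC.
  rewrite bigA_distr [RHS]big_mkcond /=; apply: eq_bigr => Q _.
  case: ifP => [QS|/negbT/subsetPn[e eQ eS]].
    rewrite -prodr_const [RHS]big_mkcond /=; apply: eq_bigr => e _.
    by case: ifP => // /(subsetP QS) ->.
  apply/eqP; rewrite prodf_seq_eq0; apply/hasP; exists e.
    by rewrite mem_index_enum.
  by rewrite eQ (negbTE eS) eqxx.
rewrite mulr_sumr; apply: ler_sum => Q _.
rewrite (eq_bigr (fun=> x ^+ #|Q|)); last by move=> F /andP[_ /eqP ->].
rewrite sumr_const -[leLHS]mulr_natl ler_wpM2r ?exprn_ge0 // -natrX ler_nat.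
apply: leq_trans (card_cluster_roots_eq Q t); apply: eq_leq.
by apply: eq_card => F; rewrite !inE andbA.
Qed.

End Clusters.

(** * Counting homomorphisms *)

Section Homomorphisms.

Variables (T : finType) (e g : rel T) (M : nat).
Hypothesis g_deg : forall y, (#|[set z | g y z]| <= M)%N.
Implicit Types (D U : {set T}) (f : {ffun T -> T}).

(** Maps on [D] are encoded as total maps fixing every point outside [D], so that each partial map
    is counted once. *)
Definition homs D : {set {ffun T -> T}} :=
  [set f : {ffun T -> T} | [forall x, (x \notin D) ==> (f x == x)] &&
           [forall x in D, forall y in D, e x y ==> g (f x) (f y)]].

Lemma homsP D f :
  reflect ((forall x, x \notin D -> f x = x) /\
           {in D &, forall x y, e x y -> g (f x) (f y)}) (f \in homs D).
Proof.
rewrite inE; apply: (iffP andP) => [[/forall_inP fD /forall_inP fe]|[fD fe]].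
  split=> [x /fD/eqP //|x y xD yD]; apply/implyP.
  by have /forall_inP := fe x xD; apply.
split; first by apply/forall_inP => x /fD ->.
by apply/forall_inP => x xD; apply/forall_inP => y yD; apply/implyP/fe.
Qed.

Definition hom_restrict D f : {ffun T -> T} := [ffun x => if x \in D then f x else x].

Lemma hom_restrictP D D' f : D \subset D' -> f \in homs D' -> hom_restrict D f \in homs D.
Proof.
move=> DD' /homsP[_ fe]; apply/homsP; split=> [x xD|x y xD yD exy].
  by rewrite ffunE (negbTE xD).
by rewrite !ffunE xD yD fe ?(subsetP DD').
Qed.

Lemma hom_restrict_inj D x f f' : f \in homs (x |: D) -> f' \in homs (x |: D) ->
  hom_restrict D f = hom_restrict D f' -> f x = f' x -> f = f'.
Proof.
move=> /homsP[fD _] /homsP[f'D _] /ffunP ff' fx; apply/ffunP => y.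
have [->//|yx] := eqVneq y x; have [yD|yD] := boolP (y \in D).
  by have := ff' y; rewrite !ffunE yD.
by rewrite fD ?f'D // !inE (negbTE yx).
Qed.

Lemma card_homs_add D x m (c : {ffun T -> T} -> {set T}) :
  (forall f, f \in homs (x |: D) -> f x \in c (hom_restrict D f)) ->
  (forall f, #|c f| <= m)%N -> (#|homs (x |: D)| <= #|homs D| * m)%N.
Proof.
move=> fc cm; rewrite -sum1_card.
rewrite [leqLHS](partition_big (hom_restrict D) (mem (homs D))) /=; last first.
  by move=> f; apply: hom_restrictP; apply: subsetUr.
rewrite -sum_nat_const; apply: leq_sum => f0 _; rewrite sum1_card.
apply: leq_trans (cm f0).
rewrite -(card_in_imset (f := fun f : {ffun T -> T} => f x)); last first.
  move=> f f'; rewrite !unfold_in /= => /andP[fH /eqP <-] /andP[f'H /eqP ff'].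
  exact: hom_restrict_inj (esym ff').
apply: subset_leq_card; apply/subsetP => _ /imsetP[f + ->].
by rewrite unfold_in /= => /andP[fH /eqP <-]; apply: fc.
Qed.

Lemma card_homs_free D : (#|homs D| <= #|T| ^ #|D|)%N.
Proof.
elim: {D}_.+1 {-2}D (ltnSn #|D|) => // m IHm D; rewrite ltnS => Dm.
have [->|[x xD]] := set_0Vmem D.
  rewrite cards0 expn0 -(cards1 [ffun x : T => x]); apply: subset_leq_card.
  apply/subsetP => f /homsP[fD _]; rewrite inE; apply/eqP/ffunP => x.
  by rewrite ffunE fD // inE.
rewrite -(setD1K xD) cardsU1 !inE eqxx add1n expnSr.
apply: leq_trans (_ : #|homs (D :\ x)| * #|T| <= _)%N.
  apply: (card_homs_add (c := fun=> setT)) => [f _|f]; first by rewrite inE.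
  by rewrite cardsT.
rewrite leq_mul2r IHm ?orbT //; apply: leq_trans Dm.
by rewrite [in X in (_ < X)%N](cardsD1 x) xD.
Qed.

(** The points of [U] outside [D] are added one at a time, each [e]-adjacent to an earlier one; its
    image is then among the at most [M] [g]-neighbours of a known point. *)
Lemma card_homs_grow D U : D \subset U -> (0 < M)%N ->
  (forall D', D \subset D' -> D' \proper U ->
     exists x y, [/\ x \in U, x \notin D', y \in D' & e y x]) ->
  (#|homs U| <= #|T| ^ #|D| * M ^ #|U|)%N.
Proof.
move=> DU M0 grow.
suff H : forall m D', D \subset D' -> D' \subset U -> #|U :\: D'| = m ->
    (#|homs U| <= #|homs D'| * M ^ m)%N.
  apply: leq_trans (H #|U :\: D| D (subxx _) DU erefl) _.
  apply: leq_mul (card_homs_free D) _.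
  by apply: leq_pexp2l => //; rewrite subset_leq_card // subsetDl.
elim=> [|m IHm] D' DD' D'U.
  move=> /eqP; rewrite cards_eq0 setD_eq0 => UD'.
  by rewrite (_ : D' = U) ?muln1 //; apply/eqP; rewrite eqEsubset D'U.
move=> cardU; have pD' : D' \proper U.
  by rewrite properE D'U -setD_eq0 -cards_eq0 cardU.
have [x [y [xU xD' yD' eyx]]] := grow D' DD' pD'.
apply: leq_trans (IHm (x |: D') _ _ _) _.
- exact: subset_trans DD' (subsetUr _ _).
- by rewrite subUset sub1set xU.
- apply/eqP; rewrite setUC -setDDl -eqSS -cardU [in eqbRHS](cardsD1 x).
  by rewrite inE xU xD'.
rewrite expnS mulnA leq_mul2r; apply/orP; right.
apply: (card_homs_add (c := fun f => [set z | g (f y) z])) => // f /homsP[_ fe].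
by rewrite inE ffunE yD' fe // !inE ?eqxx ?yD' ?orbT.
Qed.

End Homomorphisms.

Lemma card_bigcup_leq (T I : finType) (A : {set I}) (B : I -> {set T}) m :
  {in A, forall i, #|B i| <= m}%N -> (#|\bigcup_(i in A) B i| <= #|A| * m)%N.
Proof.
move=> Bm; rewrite -sum_nat_const.
apply: (@leq_trans (\sum_(i in A) #|B i|)%N); last exact: leq_sum.
elim/big_rec2: _ => [|i n U _ IH]; first by rewrite cards0.
by apply: leq_trans (leq_card_setU _ _) _; rewrite leq_add2l.
Qed.

(** * Clusters of hyperedges and their vertex sets *)

Section EdgeClusters.

Variable V : finType.
Implicit Types (e f : {set V}) (F G : {set {set V}}).

Definition edge_adj : rel {set V} := [rel e f : {set V} | ~~ [disjoint e & f]].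

(** The shadow graph of [F], with loops. Edge-preserving maps respect it, and being binary it fits
    the counting of [homs]. *)
Definition coedge F : rel V := [rel x y : V | [exists f : {set V} in F, (x \in f) && (y \in f)]].

Lemma edge_adjC : symmetric edge_adj.
Proof. by move=> e f; rewrite /edge_adj /= disjoint_sym. Qed.

Lemma edge_adjP e f : reflect (exists2 x, x \in e & x \in f) (edge_adj e f).
Proof.
rewrite /edge_adj /= -setI_eq0; apply: (iffP (set0Pn _)) => [[x]|[x xe xf]].
  by rewrite inE => /andP[]; exists x.
by exists x; rewrite inE xe.
Qed.

Variables (G : {set {set V}}) (k Delta : nat).
Hypothesis k_gt0 : (0 < k)%N.
Hypothesis G_unif : uniform k G.
Hypothesis G_deg : (max_degree G <= Delta)%N.

Lemma edge_card f : f \in G -> #|f| = k.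
Proof. by move/(forall_inP G_unif)/eqP. Qed.

Lemma edge_adj_refl F : F \subset G -> {in F, reflexive edge_adj}.
Proof.
move=> FG f /(subsetP FG) fG; apply/edge_adjP.
have : (0 < #|f|)%N by rewrite edge_card.
by rewrite card_gt0 => /set0Pn[x xf]; exists x.
Qed.

Lemma vertex_deg v : (#|[set f in G | v \in f]| <= Delta)%N.
Proof.
apply: leq_trans G_deg.
exact: (leq_bigmax (F := fun v => #|[set f in G | v \in f]|)).
Qed.

Lemma edge_adj_deg F : F \subset G ->
  {in F, forall e, #|[set f in F | edge_adj e f]| <= k * Delta}%N.
Proof.
move=> FG e eF; rewrite -(edge_card (subsetP FG e eF)).
apply: leq_trans (card_bigcup_leq (B := fun v => [set f in G | v \in f]) _); last first.
  by move=> v _; apply: vertex_deg.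
apply: subset_leq_card; apply/subsetP => f; rewrite inE => /andP[fF /edge_adjP[x xe xf]].
by apply/bigcupP; exists x; rewrite // inE (subsetP FG).
Qed.

Lemma coedge_deg v : (#|[set z | coedge G v z]| <= k * Delta)%N.
Proof.
apply: (@leq_trans (#|[set f in G | v \in f]| * k)); last first.
  by rewrite mulnC leq_mul2l vertex_deg orbT.
apply: leq_trans (card_bigcup_leq (B := id) _); last first.
  by move=> f; rewrite inE => /andP[/edge_card ->].
apply: subset_leq_card; apply/subsetP => z; rewrite inE => /existsP[f /and3P[fG vf zf]].
by apply/bigcupP; exists f; rewrite // inE fG.
Qed.

Local Notation roots F := (cluster_roots edge_adj F).

Lemma card_cover F : F \subset G -> (#|cover F| <= k * #|F|)%N.
Proof.
move=> FG; rewrite mulnC; apply: card_bigcup_leq => f /(subsetP FG) fG.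
by rewrite edge_card.
Qed.

(** One vertex of each root edge is placed freely, in at most [#|V|] ways; the other covered
    vertices are reached from these through shared edges, with at most [k * Delta] choices each. *)
Lemma card_edge_homs F : F \subset G ->
  (#|homs (coedge F) (coedge G) (cover F)|
   <= #|V| ^ #|roots F| * (k * Delta).+1 ^ #|cover F|)%N.
Proof.
move=> FG.
have rF q : q \in roots F -> q \in F.
  exact: (subsetP (cluster_roots_sub edge_adj F)).
pose D := \bigcup_(q in roots F) [set x | [pick y in q] == Some x].
have DF : (#|D| <= #|roots F|)%N.
  rewrite -[leqRHS]muln1; apply: card_bigcup_leq => q _.
  case: pickP => [y _|_]; last by rewrite (eq_card0 (_ : _ =i pred0)) // => x; rewrite inE.
  by rewrite -(cards1 y); apply: subset_leq_card; apply/subsetP => x; rewrite !inE => /eqP[->].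
have DU : D \subset cover F.
  apply/bigcupsP => q qF; apply/subsetP => x; rewrite inE.
  by case: pickP => // y yq /eqP[<-]; apply/bigcupP; exists q; rewrite ?rF.
have DM v : (#|[set z | coedge G v z]| <= (k * Delta).+1)%N.
  exact: leqW (coedge_deg v).
apply: leq_trans (card_homs_grow DM DU _ _) _ => //; last first.
  rewrite leq_mul2r; apply/orP; right.
  have [V0|V0] := posnP #|V|; last exact: leq_pexp2l.
  suff -> : roots F = set0 by rewrite cards0 V0; case: (posnP #|D|) => [->|/exp0n ->].
  apply/eqP; rewrite -subset0; apply/subsetP => q /rF/(subsetP FG)/edge_card qk.
  by move: k_gt0; rewrite -qk lt0n -leqn0 -V0 max_card.
move=> D' DD' /properP[D'U [x0 /bigcupP[f0 f0F x0f] x0D']].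
have [/existsP[y /existsP[x /and4P[xU xD' yD' eyx]]]|noxy] := boolP [exists y, exists x,
    [&& x \in cover F, x \notin D', y \in D' & coedge F y x]]; first by exists x, y.
(* otherwise [D'] contains every edge that it meets, hence whole clusters *)
have abs f : f \in F -> forall y, y \in f -> y \in D' -> f \subset D'.
  move=> fF y yf yD'; apply/subsetP => x xf; apply/negPn/negP => xD'.
  move/negP: noxy; apply; apply/existsP; exists y; apply/existsP; exists x.
  rewrite xD' yD' /=; apply/andP; split; first by apply/bigcupP; exists f.
  by apply/existsP; exists f; rewrite fF yf.
have cl : fingraph.closed (cluster_rel edge_adj F) [pred f : {set V} | f \subset D'].
  have half f f' : f' \in F -> edge_adj f f' -> f \subset D' -> f' \subset D'.
    by move=> f'F /edge_adjP[x xf xf'] fD'; apply: (abs _ f'F x) => //; apply: (subsetP fD').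
  move=> f f' /and3P[fF f'F ff']; apply/idP/idP => /=; apply: half => //.
  by rewrite edge_adjC.
have := closed_connect cl (connect_root (cluster_rel edge_adj F) f0); rewrite !inE.
set q := fingraph.root _ _.
have qR : q \in roots F by apply: (imset_f (cluster_root edge_adj F)).
(* The root meets [D'] in its picked vertex, hence lies in [D']; by closedness so does [f0], against
   the choice of [x0]. *)
have -> : q \subset D'.
  have /pred0Pn : (#|q| != 0)%N by rewrite (edge_card (subsetP FG _ (rF _ qR))) -lt0n.
  move=> [z zq0]; have zq : z \in q by [].
  have: exists2 y, y \in q & [pick y in q] == Some y.
    by case: pickP => [y yq|no]; [by exists y | by have := no z; rewrite /= zq].
  case=> y yq yP; apply: (abs _ (rF _ qR) y) => //; apply: (subsetP DD').
  by apply/bigcupP; exists q; rewrite // inE.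
by move=> f0D'; rewrite (subsetP f0D') in x0D'.
Qed.

(** Edges that share a vertex are in the same cluster, so a vertex is covered by at most one
    cluster. *)
Lemma sum_card_cover_cluster F :
  (\sum_(q in roots F) #|cover (cluster_of edge_adj F q)| <= #|cover F|)%N.
Proof.
under eq_bigr do rewrite -sum1_card big_mkcond.
rewrite exchange_big -sum1_card [leqRHS]big_mkcond /=; apply: leq_sum => x _.
have coverF q : x \in cover (cluster_of edge_adj F q) ->
    exists f, [/\ f \in F, x \in f & cluster_root edge_adj F f = q].
  by case/bigcupP => f; rewrite inE => /andP[fF /eqP fq] xf; exists f.
have [/exists_inP[q qF xq]|/exists_inPn no] :=
    boolP [exists q in roots F, x \in cover (cluster_of edge_adj F q)]; last first.
  by rewrite big1 // => q /no /negbTE ->.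
have [f [fF xf fq]] := coverF _ xq.
have -> : x \in cover F by apply/bigcupP; exists f.
rewrite (bigD1 q) //= xq big1 // => q' /andP[_ q'q].
case: ifP => // /coverF[f' [f'F xf' fq']]; case/eqP: q'q; rewrite -fq' -fq.
by apply: cluster_root_adj => //; [exact: edge_adjC | apply/edge_adjP; exists x].
Qed.

Variables (R : realType) (d alpha eps : R).
Hypothesis d_gt0 : 0 < d.
Hypothesis G_degen : degenerate d alpha eps G.

Lemma card_edges_m1 (U : {set V}) (F : {set {set V}}) :
  subgraph (U, F) G -> (1 < #|U|)%N -> #|F|%:R <= d * (#|U|%:R - 1).
Proof.
move=> UF U1; have [_ m1d _] := G_degen.
have U10 : 0 < #|U|%:R - 1 :> R by rewrite subr_gt0 ltr1n.
rewrite -ler_pdivrMr //; apply: le_trans m1d; rewrite /m1.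
have := @le_bigmax_cond _ R _ 0 (U, F)
  (fun P : {set V} * {set {set V}} => subgraph P G && (1 < #|P.1|)%N)
  (fun P => #|P.2|%:R / (#|P.1|%:R - 1)).
by rewrite /=; apply; rewrite UF.
Qed.

(* [L] counts the clusters on more than [eps * #|V|] vertices, for which the
   gain [alpha] is not available. *)
Lemma card_edges_clusters F : (2 <= k)%N -> F \subset G ->
  exists L : nat,
    [/\ #|F|%:R <= d * (#|cover F|%:R - #|roots F|%:R)
                   - alpha * (#|roots F|%:R - L%:R),
        L%:R <= eps^-1
      & #|cover F|%:R <= eps * #|V|%:R -> L = 0%N].
Proof.
move=> k2 FG; have [/andP[eps0 eps1] _ dens] := G_degen.
pose cl q := cluster_of edge_adj F q.
pose big q : bool := eps * #|V|%:R < #|cover (cl q)|%:R.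
have clF q : cl q \subset F by apply/subsetP => f; rewrite inE => /andP[].
have rF q : q \in roots F -> q \in F.
  exact: (subsetP (cluster_roots_sub edge_adj F)).
have cl2 q : q \in roots F -> (2 <= #|cover (cl q)|)%N.
  move=> qR; apply: (@leq_trans #|q|).
    by rewrite (edge_card (subsetP FG _ (rF _ qR))).
  apply: subset_leq_card; apply: (bigcup_sup q) => //; rewrite inE rF //=.
  case/imsetP: qR => f fF ->; rewrite /cluster_root root_root //.
  by apply: cluster_connect_sym; apply: edge_adjC.
have leV q : (#|cover (cl q)| <= #|cover F|)%N.
  by apply: subset_leq_card; apply/bigcupsP => f /(subsetP (clF q)) fF; apply: (bigcup_sup f).
exists (\sum_(q in roots F) big q)%N; split.
- rewrite -(sum_card_cluster edge_adj F) natr_sum.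
  (* A large cluster obeys only the [m1] bound d (v - 1), a small one the bound d (v - 1) -
     alpha. *)
  apply: (@le_trans _ _ (\sum_(q in roots F)
      (d * (#|cover (cl q)|%:R - 1) - alpha * (1 - (big q)%:R)))).
    apply: ler_sum => q qR; rewrite /big; case: ltP => [_|small].
      rewrite subrr mulr0 subr0; apply: card_edges_m1; last exact: cl2.
      rewrite /subgraph /= (subset_trans (clF q)) //=; apply/forall_inP => f fq.
      exact: (bigcup_sup f).
    rewrite subr0 mulr1; apply: le_trans (dens (cover (cl q)) (cl2 q qR) small).
    rewrite ler_nat; apply: subset_leq_card; apply/subsetP => f fq.
    by rewrite inE (subsetP FG) ?(subsetP (clF q)) //=; apply: (bigcup_sup f).
  rewrite sumrB -!mulr_sumr !sumrB -natr_sum -natr_sum !sumr_const.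
  by rewrite lerD2r ler_wpM2l ?(ltW d_gt0) // lerD2r ler_nat sum_card_cover_cluster.
(* Large clusters are vertex-disjoint and cover more than eps n vertices each, so there are at most
   1/eps of them. *)
- rewrite -[leRHS]mul1r ler_pdivlMr //.
  have [V0|V0] := posnP #|V|.
    rewrite big1 ?mul0r // => q qR; have := leq_trans (cl2 q qR) (max_card _).
    by rewrite V0.
  have VR : 0 < #|V|%:R :> R by rewrite ltr0n.
  rewrite -(ler_pM2r VR) mul1r.
  apply: (@le_trans _ _ #|cover F|%:R); last by rewrite ler_nat max_card.
  apply: (@le_trans _ _ (\sum_(q in roots F) #|cover (cl q)|)%N%:R); last first.
    by rewrite ler_nat sum_card_cover_cluster.
  rewrite !natr_sum -mulrA mulr_suml; apply: ler_sum => q _.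
  by rewrite /big; case: ltP => [/ltW|]; rewrite ?mul1r ?mul0r.
- move=> small; rewrite big1 // => q qR; rewrite /big ltNge.
  by rewrite (le_trans _ small) // ler_nat.
Qed.

End EdgeClusters.

(** * Random subsets and minimal fragments *)

Lemma sum_le_prob (R : realType) (T I : finType) (mu : T -> R) (P : pred T) (Q : I -> pred T)
    (J : pred I) :
  (forall x, 0 <= mu x) ->
  (forall x, mu x != 0 -> P x -> exists2 i, J i & Q i x) ->
  prob mu P <= \sum_(i | J i) prob mu (Q i).
Proof.
move=> mu0 PQ; rewrite /prob.
under [leRHS]eq_bigr do rewrite big_mkcond.
rewrite exchange_big /= [leLHS]big_mkcond /=; apply: ler_sum => x _.
have s0 : 0 <= \sum_(i | J i) (if Q i x then mu x else 0).
  by apply: sumr_ge0 => i _; case: ifP.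
case: ifP => // Px; have [mx|/PQ/(_ Px)[i Ji Qi]] := eqVneq (mu x) 0.
  by rewrite [leLHS]mx.
by rewrite (bigD1 i) //= Qi lerDl; apply: sumr_ge0 => j _; case: ifP.
Qed.

Lemma prob_le (R : realType) (T : finType) (mu : T -> R) (P Q : pred T) :
  (forall x, 0 <= mu x) -> (forall x, P x -> mu x != 0 -> Q x) ->
  prob mu P <= prob mu Q.
Proof.
move=> mu0 PQ; rewrite /prob [leLHS]big_mkcond [leRHS]big_mkcond /=.
apply: ler_sum => x _; case: ifP => Px; last by case: ifP.
case: ifP => // Qx; have [->//|/(PQ _ Px)] := eqVneq (mu x) 0.
by rewrite Qx.
Qed.

Section Bernoulli.

Variables (R : realType) (X : finType).
Implicit Types (a b : X -> R) (W T K : {set X}).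

(** The law of a random set containing each [x] independently with probability [a x]. Taking [a]
    zero outside [K] gives random subsets of [K]. *)
Definition bern a W : R := \prod_x (if x \in W then a x else 1 - a x).

Lemma bern_ge0 a W : (forall x, 0 <= a x <= 1) -> 0 <= bern a W.
Proof.
move=> a01; apply: prodr_ge0 => x _; have /andP[a0 a1] := a01 x.
by case: ifP; rewrite // subr_ge0.
Qed.

Lemma sum_bern a : \sum_W bern a W = 1.
Proof.
by rewrite /bern -bigA_distr big1 // => x _; rewrite /=; ring.
Qed.

(** The union of two independent random sets misses a point exactly when both miss it. *)
Lemma sum_bernU a b (f : {set X} -> R) :
  \sum_W bern a W * (\sum_Z bern b Z * f (W :|: Z)) =
  \sum_W bern (fun x => 1 - (1 - a x) * (1 - b x)) W * f W.
Proof.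
under eq_bigr do rewrite mulr_sumr.
rewrite pair_big /= (partition_big (fun p => p.1 :|: p.2) predT) //=.
apply: eq_bigr => U _.
rewrite (eq_bigr (fun p => bern a p.1 * bern b p.2 * f U)); last first.
  by move=> p /eqP <-; rewrite mulrA.
rewrite -mulr_suml; congr (_ * _).
(* The joint weight at [x] of memberships [i] and [j] in the two sets, kept only if it is consistent
   with the union being [U]. *)
pose h (i j : bool) x := (if i then a x else 1 - a x) *
   (if j then b x else 1 - b x) * ((i || j) == (x \in U))%:R.
transitivity (\prod_x ((h true true x + h true false x)
                       + (h false true x + h false false x))); last first.
  apply: eq_bigr => x _; rewrite /h /=; case: (x \in U) => /=; ring.
rewrite bigA_distr.
have hE (W : {set X}) : \prod_x (if x \in W then h true true x + h true false x
                     else h false true x + h false false x) =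
    \sum_(Z : {set X}) \prod_x h (x \in W) (x \in Z) x.
  transitivity (\prod_x (h (x \in W) true x + h (x \in W) false x)).
    by apply: eq_bigr => x _; case: ifP.
  rewrite bigA_distr; apply: eq_bigr => Z _; apply: eq_bigr => x _.
  by case: (x \in Z).
under [RHS]eq_bigr do rewrite hE.
rewrite pair_big /= [LHS]big_mkcond /=; apply: eq_bigr => -[W Z] _ /=.
have [WZU|WZU] := boolP (W :|: Z == U).
  rewrite -big_split; apply: eq_bigr => x _ /=.
  rewrite /h -(eqP WZU) !inE; case: (x \in W); case: (x \in Z); rewrite /= ?eqxx; ring.
apply/esym/eqP; rewrite prodf_seq_eq0.
have /existsP[x Hx] : [exists x, (x \in W :|: Z) != (x \in U)].
  apply: contraNT WZU => /existsPn WZU; apply/eqP/setP => x.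
  by have /negPn/eqP := WZU x.
apply/hasP; exists x; first by rewrite mem_index_enum.
move: Hx; rewrite !inE /h; case: (x \in W); case: (x \in Z); case: (x \in U);
  by rewrite //= mulr0.
Qed.

(** On [T] the factor [1 - a x] becomes [p], and [(1 - a x) * p] is at most [p]: removing [T] from a
    random set costs at most a factor p^-|T|. *)
Lemma bern_setU a W T p : (forall x, 0 <= a x <= 1) -> [disjoint W & T] ->
  (forall x, x \in T -> a x = p) -> bern a W * p ^+ #|T| <= bern a (W :|: T).
Proof.
move=> a01 /pred0P dWT aT.
have -> : p ^+ #|T| = \prod_x (if x \in T then p else 1).
  by rewrite -big_mkcond prodr_const.
rewrite /bern -big_split; apply: ler_prod => x _ /=.
have /andP[a0 a1] := a01 x; rewrite !inE.
have [xT|xT] := boolP (x \in T).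
  have:= dWT x; rewrite /= xT andbT => -> /=; rewrite -(aT x xT).
  by apply/andP; split; nra.
by rewrite mulr1 orbF lexx andbT; case: ifP; rewrite // subr_ge0.
Qed.

Lemma bern_const K p W :
  bern (fun x => if x \in K then p else 0) W =
  if W \subset K then p ^+ #|W| * (1 - p) ^+ (#|K| - #|W|) else 0.
Proof.
case: ifP => [WK|/negbT /subsetPn[x xW xK]]; last first.
  by apply/eqP; rewrite prodf_seq_eq0; apply/hasP; exists x;
    rewrite ?mem_index_enum //= xW (negbTE xK).
rewrite -(setIidPr WK) -cardsD (setIidPr WK).
rewrite /bern (bigID (mem W)) /=; congr (_ * _).
  rewrite -[_ ^+ _]prodr_const; apply: eq_bigr => x xW.
  by rewrite xW (subsetP WK).
rewrite -[_ ^+ _]prodr_const [LHS]big_mkcond [RHS]big_mkcond /=.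
apply: eq_bigr => x _; rewrite !inE; case: (x \in W) => //=.
by case: (x \in K); rewrite // subr0.
Qed.

End Bernoulli.

Lemma sum_inj_le (R : numDomainType) (I J : finType) (P : pred I) (Q : pred J)
    (f : I -> J) (F : J -> R) :
  {in P &, injective f} -> (forall i, P i -> Q (f i)) -> (forall j, 0 <= F j) ->
  \sum_(i | P i) F (f i) <= \sum_(j | Q j) F j.
Proof.
move=> fI PQ F0.
rewrite -(big_imset F (A := P)) //= [leLHS]big_mkcond [leRHS]big_mkcond /=.
apply: ler_sum => j _; case: ifP => [/imsetP[i Pi ->]|_].
  by rewrite PQ.
by case: ifP.
Qed.

Lemma sum_expr_le2 (R : realFieldType) (y : R) n :
  0 <= y <= 2^-1 -> \sum_(i < n) y ^+ i <= 2.
Proof.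
move=> /andP[y0 y2]; elim: n => [|n IHn]; first by rewrite big_ord0.
rewrite big_ord_recl expr0; under eq_bigr do rewrite exprS.
by rewrite -mulr_sumr; nra.
Qed.

Section Fragments.

Variables (R : realType) (X : finType).
Implicit Types (nu : {set X} -> R) (A B K S T W Z : {set X}).

Definition hit nu W : bool := [exists A, (nu A != 0) && (A \subset W)].

(** The support of [nu] plays the role of the edge set; [S] is itself a candidate, so the minimum
    exists once [nu S] is nonzero. *)
Definition minfrag nu W S : {set X} :=
  [arg min_(A < S | (nu A != 0) && (A \subset S :|: W)) #|A :\: W|] :\: W.

Lemma minfragP nu W S : nu S != 0 ->
  exists A, [/\ nu A != 0, A \subset S :|: W, minfrag nu W S = A :\: W
    & forall B, nu B != 0 -> B \subset S :|: W ->
        (#|minfrag nu W S| <= #|B :\: W|)%N].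
Proof.
move=> nuS; rewrite /minfrag.
case: (@arg_minnP _ S) => [|A /andP[nuA AS] Amin]; first by rewrite nuS subsetUl.
by exists A; split=> // B nuB BS; apply: Amin; rewrite nuB.
Qed.

Lemma minfrag_sub nu W S : nu S != 0 -> minfrag nu W S \subset S.
Proof. by case/(minfragP W) => A [_ AS -> _]; rewrite subDset setUC. Qed.

Lemma minfrag_disjoint nu W S : [disjoint W & minfrag nu W S].
Proof. by rewrite -setI_eq0 setIDA setIC -setIDA setDv setI0. Qed.

Lemma hit_minfrag nu W S : nu S != 0 -> hit nu (W :|: minfrag nu W S).
Proof.
case/(minfragP W) => A [nuA _ -> _]; apply/existsP; exists A.
by rewrite nuA -subDset subxx.
Qed.

(* Given only [W :|: minfrag nu W S], the fragment is therefore one of the subsets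
   of a fixed edge: this is what bounds the number of pairs [(W, S)]. *)
Lemma minfrag_sub_hit nu W S A : nu S != 0 -> nu A != 0 ->
  A \subset W :|: minfrag nu W S -> minfrag nu W S \subset A.
Proof.
move=> nuS nuA AW; have fS := minfrag_sub W nuS.
have [_ [_ _ _ fmin]] := minfragP W nuS.
have AWf : A :\: W \subset minfrag nu W S by rewrite subDset.
have le_f : (#|minfrag nu W S| <= #|A :\: W|)%N.
  by apply: fmin => //; apply: (subset_trans AW); rewrite setUC setSU.
have /eqP <- : A :\: W == minfrag nu W S by rewrite eqEcard AWf.
exact: subsetDl.
Qed.

(** A pair [(W, S)] with fragment [T] is encoded by [(W :|: T, T)] at cost p^-|T|. Given [Z] and
    [S], the set [T] is one of the 2^j subsets of [S :&: edge Z], an intersection of size j; this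
    size has probability at most q^j, which leaves a geometric series in 2q/p. *)
Lemma sum_large_minfrag nu K (p q rho : R) :
  (forall A, 0 <= nu A) -> (forall A, nu A != 0 -> A \subset K) ->
  0 < p <= 1 -> 0 <= q -> 2 * q / p <= 2^-1 -> 0 < rho ->
  (forall A (j : nat), nu A != 0 -> rho < j%:R ->
     prob nu [pred B | (j <= #|B :&: A|)%N] <= q ^+ j) ->
  \sum_W bern (fun x => if x \in K then p else 0) W *
    (\sum_(S | (nu S != 0) && (rho < #|minfrag nu W S|%:R)) nu S)
  <= 2 * (2 * q / p).
Proof.
move=> nu0 nuK /andP[p0 p1] q0 y2 rho0 spr.
set a : X -> R := fun x => if x \in K then p else 0; set y := 2 * q / p in y2 *.
have y0 : 0 <= y by rewrite divr_ge0 ?mulr_ge0 // ltW.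
have a01 x : 0 <= a x <= 1 by rewrite /a; case: ifP; rewrite ?lexx ?ler01 // ltW.
pose edge (Z : {set X}) := odflt set0 [pick A : {set X} | (nu A != 0) && (A \subset Z)].
have edgeP Z : hit nu Z -> nu (edge Z) != 0 /\ edge Z \subset Z.
  rewrite /edge => /existsP[A HA].
  by case: pickP => [B /andP[]//|/(_ A)]; rewrite HA.
pose w (ZT : {set X} * {set X}) := bern a ZT.1 * p ^- #|ZT.2|.
have w0 ZT : 0 <= w ZT.
  by rewrite mulr_ge0 ?bern_ge0 // invr_ge0 exprn_ge0 // ltW.
pose ok (S : {set X}) (ZT : {set X} * {set X}) :=
  [&& hit nu ZT.1, rho < #|ZT.2|%:R & ZT.2 \subset S :&: edge ZT.1].
have encode S : nu S != 0 ->
    \sum_(W | rho < #|minfrag nu W S|%:R) bern a W <=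
    \sum_(ZT | ok S ZT) w ZT.
  move=> nuS; pose f W := (W :|: minfrag nu W S, minfrag nu W S).
  apply: le_trans (sum_inj_le (f := f) (P := [pred W | rho < #|minfrag nu W S|%:R]) _ _ w0).
  - apply: ler_sum => W _; rewrite /w /= ler_pdivlMr ?exprn_gt0 //.
    apply: bern_setU => //; first exact: minfrag_disjoint.
    by move=> x /(subsetP (minfrag_sub W nuS))/(subsetP (nuK _ nuS)); rewrite /a => ->.
  - move=> W W' _ _ [eWU eW]; move: eWU; rewrite eW => eWU.
    have := congr1 (fun U => U :\: minfrag nu W' S) eWU.
    rewrite !setDUl setDv !setU0 -{1}eW.
    by rewrite !(setDidPl _) ?minfrag_disjoint.
  - move=> W /= rW; rewrite /ok /= hit_minfrag // rW subsetI minfrag_sub //=.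
    have [nuE EW] := edgeP _ (hit_minfrag W nuS).
    exact: minfrag_sub_hit.
have count Z : hit nu Z ->
    \sum_(S : {set X}) nu S *
      \sum_(T : {set X} | (rho < #|T|%:R) && (T \subset S :&: edge Z)) p ^- #|T|
    <= 2 * y.
  move=> hZ; have [nuE _] := edgeP _ hZ.
  pose N := #|X|.
  (* At most 2^j sets [T], each of weight at most p^-j. The index is shifted because an intersection
     larger than [rho] is nonempty. *)
  apply: (@le_trans _ _ (\sum_(S : {set X}) nu S * \sum_(i < N)
      (if (rho < i.+1%:R) && (#|S :&: edge Z| == i.+1) then (2 / p) ^+ i.+1 else 0))).
    apply: ler_sum => S _; apply: ler_wpM2l => //.
    have [rS|rS] := ltP rho #|S :&: edge Z|%:R; last first.
      rewrite big_pred0.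
        by apply: sumr_ge0 => i _; case: ifP => // _; rewrite exprn_ge0 // divr_ge0 // ltW.
      move=> T; apply/negP => /andP[rT /subset_leq_card TS].
      by have := lt_le_trans rT (le_trans _ rS); rewrite ltxx ler_nat => /(_ TS).
    have c0 : (0 < #|S :&: edge Z|)%N by rewrite -(ltr_nat R) (lt_trans rho0).
    have cN : (#|S :&: edge Z|.-1 < N)%N by rewrite prednK // max_card.
    rewrite (bigD1 (Ordinal cN)) //= prednK // rS eqxx /= ler_wpDr //.
      by apply: sumr_ge0 => i _; case: ifP => // _; rewrite exprn_ge0 // divr_ge0 // ltW.
    apply: (@le_trans _ _ (\sum_(T in powerset (S :&: edge Z)) p ^- #|S :&: edge Z|)).
      rewrite [leLHS]big_mkcond [leRHS]big_mkcond /=; apply: ler_sum => T _.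
      rewrite powersetE; case: (boolP (T \subset _)) => [TS|_]; last by rewrite andbF.
      rewrite andbT; have pT : 0 <= p ^- #|S :&: edge Z| by rewrite invr_ge0 exprn_ge0 // ltW.
      case: ifP => // _; rewrite lef_pV2 ?posrE ?exprn_gt0 //.
      by apply: ler_wiXn2l => //; [exact: ltW|exact: subset_leq_card].
    by rewrite sumr_const card_powerset -[leLHS]mulr_natl natrX expr_div_n.
  under eq_bigr do rewrite mulr_sumr.
  rewrite exchange_big /=.
  apply: (@le_trans _ _ (\sum_(i < N) y ^+ i.+1)); last first.
    under eq_bigr do rewrite exprS.
    rewrite -mulr_sumr mulrC ler_wpM2r //; apply: sum_expr_le2.
    by rewrite y0.
  apply: ler_sum => i _.
  have [ri|_] := ltP rho i.+1%:R; last first.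
    by rewrite big1 ?exprn_ge0 // => S _; rewrite mulr0.
  apply: (@le_trans _ _ ((2 / p) ^+ i.+1 * q ^+ i.+1)); last first.
    by rewrite -exprMn /y mulrAC.
  apply: le_trans (ler_wpM2l _ (spr _ _ nuE ri)); last first.
    by rewrite exprn_ge0 // divr_ge0 // ltW.
  rewrite /prob mulr_sumr [leRHS]big_mkcond /=; apply: ler_sum => S _ /=.
  have [->|_] := eqVneq #|S :&: edge Z| i.+1; first by rewrite leqnn mulrC.
  by rewrite mulr0; case: ifP => // _; rewrite mulr_ge0 // exprn_ge0 // divr_ge0 // ltW.
apply: (@le_trans _ _ (\sum_(S : {set X}) nu S * \sum_(ZT | ok S ZT) w ZT)).
  under eq_bigr do rewrite mulr_sumr big_mkcond.
  rewrite exchange_big /=; apply: ler_sum => S _.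
  have [nuS|nuS] := eqVneq (nu S) 0.
    by rewrite big1 ?nuS ?mul0r // => W _; rewrite /= nuS eqxx.
  under eq_bigr do rewrite /= mulrC.
  by rewrite -big_mkcond -mulr_sumr ler_wpM2l // encode.
rewrite (eq_bigr (fun S => \sum_(Z : {set X}) \sum_(T : {set X})
    if ok S (Z, T) then nu S * w (Z, T) else 0)); last first.
  move=> S _; rewrite big_mkcond pair_bigA mulr_sumr; apply: eq_bigr => -[Z T] _ /=.
  by case: ifP; rewrite ?mulr0.
rewrite exchange_big /=.
apply: (@le_trans _ _ (\sum_(Z : {set X}) bern a Z * (2 * y))); last first.
  by rewrite -mulr_suml sum_bern mul1r.
apply: ler_sum => Z _; have [hZ|hZ] := boolP (hit nu Z); last first.
  rewrite big1 ?(mulr_ge0 (bern_ge0 Z a01)) ?(mulr_ge0 _ y0) // => S _; rewrite big1 // => T _.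
  by rewrite /ok /= (negbTE hZ).
apply: le_trans (ler_wpM2l (bern_ge0 Z a01) (count Z hZ)).
rewrite mulr_sumr; apply: ler_sum => S _.
rewrite mulrCA mulr_sumr mulr_sumr [leRHS]big_mkcond /=; apply: ler_sum => T _.
by rewrite /ok /w /= hZ.
Qed.

(** The law of the fragments of size at most [rho], not renormalised: the lost mass is the [nu]-mass
    of the sets with a large fragment. *)
Definition shrink nu W (rho : R) T : R :=
  \sum_(S | [&& nu S != 0, #|minfrag nu W S|%:R <= rho & minfrag nu W S == T]) nu S.

Lemma shrink_supp nu W rho T : shrink nu W rho T != 0 ->
  exists S, [/\ nu S != 0, #|minfrag nu W S|%:R <= rho & minfrag nu W S = T].
Proof.
move=> nz; suff /existsP[S /and3P[nuS Sr /eqP ST]] :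
  [exists S, [&& nu S != 0, #|minfrag nu W S|%:R <= rho & minfrag nu W S == T]].
  by exists S.
apply: contraNT nz => /existsPn noS; rewrite /shrink big_pred0 // => S.
exact/negbTE/noS.
Qed.

Lemma prob_shrink nu W rho (P : pred {set X}) :
  prob (shrink nu W rho) P =
  \sum_(S | [&& nu S != 0, #|minfrag nu W S|%:R <= rho & P (minfrag nu W S)]) nu S.
Proof.
rewrite [RHS](partition_big (minfrag nu W) P) /=; last by move=> S /and3P[].
apply: eq_bigr => T PT; apply: eq_bigl => S.
by case: (minfrag nu W S =P T) => [->|_]; rewrite ?PT ?andbT ?andbF.
Qed.

Lemma eq_bern (a b : X -> R) W : a =1 b -> bern a W = bern b W.
Proof. by move=> ab; apply: eq_bigr => x _; rewrite ab. Qed.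

Lemma bern_const01 K (p : R) x : 0 <= p <= 1 -> 0 <= (if x \in K then p else 0) <= 1.
Proof. by case: ifP; rewrite // lexx ler01. Qed.

(** Induction on the number of rounds. The first set [W] turns [nu] into [shrink nu W (rho 1)], and
    a later hit of that measure, joined with [W], is a hit of [nu]. Thanks to the factor of total
    mass, the losses, at most 4q/p on average per round, simply add up. *)
Lemma mass_no_hit K p q L (rho : nat -> R) nu :
  (forall A, 0 <= nu A) -> (forall A, nu A != 0 -> A \subset K) ->
  0 < p <= 1 -> 0 <= q -> 2 * q / p <= 2^-1 ->
  (forall i, (i <= L)%N -> 0 < rho i) -> rho L < 1 ->
  (forall A, nu A != 0 -> #|A|%:R <= rho 0%N) ->
  (forall i A S (j : nat), (i < L)%N -> nu A != 0 -> S \subset A ->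
     #|S|%:R <= rho i -> rho i.+1 < j%:R ->
     prob nu [pred B | (j <= #|B :&: S|)%N] <= q ^+ j) ->
  (\sum_A nu A) *
    (\sum_W bern (fun x => if x \in K then 1 - (1 - p) ^+ L else 0) W *
       (~~ hit nu W)%:R) <= L%:R * (2 * (2 * q / p)).
Proof.
move=> + + p01 q0 y2; have /andP[p0 p1] := p01.
elim: L rho nu => [|L IHL] rho nu nu0 nuK rho0 rhoL nurho spr.
  (* With no round left [rho 0 < 1], so the sets in the support are empty and lie in every [W]. *)
  rewrite mul0r; have [/existsP[A nuA]|/existsPn noA] := boolP [exists A, nu A != 0].
    have A0 : A = set0.
      have := le_lt_trans (nurho A nuA) rhoL.
      by rewrite -[1]/(1%:R) ltr_nat ltnS leqn0 cards_eq0 => /eqP.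
    rewrite [X in _ * X]big1 ?mulr0 // => W _.
    suff -> : hit nu W by rewrite mulr0.
    by apply/existsP; exists A; rewrite nuA A0 sub0set.
  by rewrite [X in X * _]big1 ?mul0r // => A _; apply/eqP; have /negPn := noA A.
set a : X -> R := fun x => if x \in K then p else 0.
set b : X -> R := fun x => if x \in K then 1 - (1 - p) ^+ L else 0.
have a01 x : 0 <= a x <= 1 by rewrite bern_const01 // ltW.
have b01 x : 0 <= b x <= 1.
  rewrite bern_const01 // subr_ge0 gerBl exprn_ge0 ?subr_ge0 // andbT.
  by rewrite exprn_ile1 ?subr_ge0 // gerBl ltW.
have bernE W : bern (fun x => if x \in K then 1 - (1 - p) ^+ L.+1 else 0) W =
    bern (fun x => 1 - (1 - a x) * (1 - b x)) W.
  by apply: eq_bern => x; rewrite /a /b; case: ifP => _; rewrite ?exprS; ring.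
under [X in _ * X]eq_bigr do rewrite bernE.
rewrite -(sum_bernU a b (fun W => (~~ hit nu W)%:R)) mulr_sumr.
pose bad W := \sum_(S | (nu S != 0) && (rho 1%N < #|minfrag nu W S|%:R)) nu S.
have step W : (\sum_A nu A) * (\sum_Z bern b Z * (~~ hit nu (W :|: Z))%:R) <=
    L%:R * (2 * (2 * q / p)) + bad W.
  pose nu' := shrink nu W (rho 1%N).
  have massE : \sum_A nu A = \sum_A nu' A + bad W.
    transitivity (\sum_(A | nu A != 0) nu A).
      by rewrite [RHS]big_mkcond; apply: eq_bigr => A _; case: eqP.
    rewrite (bigID (fun A => #|minfrag nu W A|%:R <= rho 1%N)) /=; congr (_ + _).
      rewrite -[RHS]/(prob nu' predT) prob_shrink.
      by apply: eq_bigl => A; rewrite andbT.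
    by apply: eq_bigl => A; rewrite -ltNge.
  have fail0 Z (f : bool) : 0 <= bern b Z * f%:R by rewrite mulr_ge0 ?bern_ge0.
  have bad0 : 0 <= bad W by apply: sumr_ge0.
  rewrite massE mulrDl; apply: lerD; last first.
    rewrite -[leRHS]mulr1; apply: ler_wpM2l => //.
    rewrite -[leRHS](sum_bern b); apply: ler_sum => Z _.
    by case: (hit _ _); rewrite /= ?mulr1 ?mulr0 ?lexx ?bern_ge0.
  have nu'0 A : 0 <= nu' A by apply: sumr_ge0.
  have nu'P A : nu' A != 0 -> exists S, [/\ nu S != 0, A \subset S & A = minfrag nu W S].
    case/shrink_supp => S [nuS _ <-]; exists S; split=> //.
    exact: minfrag_sub.
  apply: le_trans (IHL (fun i => rho i.+1) nu' _ _ _ _ _ _) => //.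
  - apply: ler_wpM2l; first exact: sumr_ge0.
    apply: ler_sum => Z _; apply: ler_wpM2l; first exact: bern_ge0.
    rewrite ler_nat; have [/existsP[A /andP[nuA AZ]]|_] := boolP (hit nu' Z); last exact: leq_b1.
    have [S [nuS _ AE]] := nu'P _ nuA.
    have /existsP[B /andP[nuB BW]] := hit_minfrag W nuS.
    suff -> : hit nu (W :|: Z) by [].
    apply/existsP; exists B; rewrite nuB (subset_trans BW) // -AE.
    by rewrite setUS.
  - by move=> A /nu'P[S [nuS AS _]]; apply: subset_trans (nuK _ nuS).
  - by move=> i iL; apply: rho0.
  - by move=> A /shrink_supp[S [_ Sr <-]].
  (* Fragments are subsets of the original sets: intersections with [S] only shrink, and [S] still
     lies in a set of the support of [nu]. *)
  - move=> i A S j iL /nu'P[S' [nuS' AS' _]] SA Sr rj.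
    apply: le_trans (spr i.+1 S' S j iL nuS' (subset_trans SA AS') Sr rj).
    rewrite prob_shrink /prob [leLHS]big_mkcond [leRHS]big_mkcond /=.
    apply: ler_sum => B _; case: ifP => [/and3P[nuB _ /= jB]|_]; last by case: ifP.
    by rewrite (leq_trans jB) // subset_leq_card // setSI // minfrag_sub.
apply: (@le_trans _ _ (\sum_W bern a W * (L%:R * (2 * (2 * q / p)) + bad W))).
  by apply: ler_sum => W _; rewrite mulrCA ler_wpM2l // bern_ge0.
under eq_bigr do rewrite mulrDr.
rewrite big_split /= -mulr_suml sum_bern mul1r -[L.+1%:R]natr1 [leRHS]mulrDl mul1r lerD2l.
apply: (@sum_large_minfrag nu K p q (rho 1%N)) => //; first exact: rho0.
move=> A j nuA rj; apply: (spr 0%N A A) => //; exact: nurho.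
Qed.

End Fragments.

Lemma bernoulli_ineq (R : realDomainType) (x : R) n :
  0 <= x <= 1 -> 1 - n%:R * x <= (1 - x) ^+ n.
Proof.
move=> /andP[x0 x1]; elim: n => [|n IHn]; first by rewrite mul0r subr0.
rewrite exprS -[n.+1%:R]natr1; have n0 : 0 <= n%:R :> R by [].
have := ler_wpM2l (_ : 0 <= 1 - x) IHn; rewrite subr_ge0 => /(_ x1).
by apply: le_trans; nra.
Qed.

(** * From a spread measure to a hitting probability *)

Section SpreadThreshold.

Variables (R : realType) (X : finType).

Lemma no_hit_spread (K : {set X}) (HH : {set {set X}}) (mu : {set X} -> R)
    (q p : R) (l : nat) (r : nat -> R) :
  (0 < l)%N -> r l = 1 -> spread q l r HH mu ->
  (forall A, A \in HH -> A \subset K) -> 0 < p <= 1 ->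
  \sum_W bern (fun x => if x \in K then p else 0) W *
    (~~ [exists A, (A \in HH) && (A \subset W)])%:R
  <= l%:R * (2 * (2 * q / (p / l%:R))).
Proof.
move=> l0 rl [/andP[q0 q1] rdec rHH [[mu0 mu1] supp] spr] HHK /andP[p0 p1].
have lR : 1 <= l%:R :> R by rewrite ler1n.
have lR0 : 0 < l%:R :> R by rewrite ltr0n.
pose g (W : {set X}) := [exists A, (A \in HH) && (A \subset W)].
pose f (W : {set X}) : R := (~~ g W)%:R.
rewrite -[leLHS]/(\sum_W bern (fun x => if x \in K then p else 0) W * f W).
set y := 2 * q / (p / l%:R).
have y0 : 0 <= y by rewrite /y !mulr_ge0 ?invr_ge0 ?divr_ge0 // ltW.
(* For [y > 1/2] the claimed bound exceeds 1. *)
have [y2|y2] := leP y 2^-1; last first.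
  apply: (@le_trans _ _ 1); last by nra.
  rewrite -[leRHS](sum_bern (fun x => if x \in K then p else 0)).
  apply: ler_sum => W _; have bW : 0 <= bern (fun x => if x \in K then p else 0) W.
    by apply: bern_ge0 => x; rewrite bern_const01 // p1 ltW.
  by rewrite /f; case: (g W); rewrite /= ?mulr1 ?mulr0.
have pl : 0 < p / l%:R <= 1.
  by rewrite divr_gt0 // ler_pdivrMr // mul1r (le_trans p1).
(* The probability that all [l] rounds miss a given point of [K]. *)
pose u := (1 - p / l%:R) ^+ l.
have up : 1 - p <= u.
  have := @bernoulli_ineq R (p / l%:R) l.
  by rewrite [l%:R * _]mulrC divfK ?gt_eqF //; apply; case/andP: pl => /ltW -> ->.
have u01 : 0 <= u <= 1.
  case/andP: pl => pl0 pl1; rewrite exprn_ge0 ?subr_ge0 //=.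
  by rewrite exprn_ile1 ?subr_ge0 // gerBl ltW.
(* A [p]-random set is the union of [l] independent [p / l]-random sets and of
   one more [s]-random set, which only helps. *)
pose s := 1 - (1 - p) / u.
have us : u * (1 - s) = 1 - p.
  rewrite /s subKr; have [u0|u0] := eqVneq u 0; last by rewrite mulrC divfK.
  by move: up; rewrite u0 mul0r; lra.
have s01 : 0 <= s <= 1.
  case/andP: u01 => u0 u1; rewrite /s subr_ge0 gerBl divr_ge0 ?subr_ge0 // andbT.
  have [->|uz] := eqVneq u 0; first by rewrite invr0 mulr0.
  by rewrite ler_pdivrMr ?mul1r // lt0r uz.
pose a (x : X) := if x \in K then 1 - u else 0.
pose b (x : X) := if x \in K then s else 0.
have a01 x : 0 <= a x <= 1 by rewrite bern_const01 // subr_ge0 gerBl andbC.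
have b01 x : 0 <= b x <= 1 by rewrite bern_const01.
have bernE W : bern (fun x => if x \in K then p else 0) W =
    bern (fun x => 1 - (1 - a x) * (1 - b x)) W.
  apply: eq_bern => x; rewrite /a /b; case: ifP => _; last by ring.
  by transitivity (1 - u * (1 - s)); [rewrite us; ring | ring].
under eq_bigr do rewrite bernE.
rewrite -(sum_bernU a b f).
apply: (@le_trans _ _ (\sum_W bern a W * f W)).
  apply: ler_sum => W _; apply: ler_wpM2l; first exact: bern_ge0.
  rewrite -[leRHS]mul1r -(sum_bern b) mulr_suml; apply: ler_sum => Z _.
  apply: ler_wpM2l; first exact: bern_ge0.
  rewrite /f ler_nat; have [/existsP[A /andP[AH AW]]|_] := boolP (g W);
    last exact: leq_b1.
  suff -> : g (W :|: Z) by [].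
  by apply/existsP; exists A; rewrite AH (subset_trans AW) // subsetUl.
have rgt i : (i <= l)%N -> 1 <= r i.
  move=> il; rewrite -(subKn il); elim: (l - i)%N => [|j IHj]; first by rewrite subn0 rl.
  have [jl|jl] := ltnP j l; last first.
    by move: IHj; rewrite (eqP (jl : l - j == 0)%N) (eqP (leqW jl : l - j.+1 == 0)%N).
  apply: le_trans IHj (ltW _).
  have -> : (l - j = (l - j.+1).+1)%N by rewrite subnSK.
  by apply: rdec; rewrite ltn_subrL l0.
(* The rounds must end below 1, whereas [r l = 1]. Sizes are integers, and exceeding 1/2 means being
   at least 1. *)
pose rho i := if i == l then 2^-1 else r i.
have inv2 : 0 < 2^-1 :> R by rewrite invr_gt0.
have := @mass_no_hit R X K (p / l%:R) q l rho mu mu0.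
rewrite mu1 mul1r -/u => mass.
apply: le_trans (mass _ pl q0 y2 _ _ _ _).
- apply: ler_sum => W _; apply: ler_wpM2l; first exact: bern_ge0.
  rewrite /f ler_nat; have [/existsP[A /andP[AH AW]]|_] := boolP (hit mu W); last exact: leq_b1.
  suff -> : g W by [].
  by apply/existsP; exists A; rewrite AW (supp _ AH).
- by move=> A /supp; apply: HHK.
- by move=> i il; rewrite /rho; case: ifP => // _; apply: lt_le_trans (rgt i il).
- by rewrite /rho eqxx invf_lt1 ?ltr1n.
- by move=> A /supp AH; rewrite /rho eq_sym gtn_eqF // rHH.
- move=> i A S j il muA SA; rewrite /rho (ltn_eqF il) => Sr rj.
  have [jS|jS] := leqP j #|S|; last first.
    rewrite /prob big_pred0 ?exprn_ge0 // => B /=; apply/negbTE; rewrite -ltnNge.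
    by apply: leq_ltn_trans jS; rewrite subset_leq_card // subsetIr.
  have rij : r i.+1 <= j%:R.
    move: rj; have [->|_] := eqVneq i.+1 l; last exact: ltW.
    rewrite rl ler1n => j2; case: j j2 {jS} => //; rewrite ltNge ltW //.
  have jSR : j%:R <= #|S|%:R :> R by rewrite ler_nat.
  have := spr i.+1 _ j%:R _ A S (supp _ muA) SA.
  rewrite /= il rij (le_trans jSR Sr) (le_trans rij jSR) Sr => /(_ isT isT isT).
  rewrite powR_mulrn //; apply: le_trans; apply: prob_le => // B /= jB _.
  by rewrite ler_nat.
Qed.

End SpreadThreshold.

(** * Spread of the copies of a degenerate hypergraph *)

Lemma prob_vertex_spread (R : realType) (V W : finType) (q : R)
    (mu : {ffun V -> W} -> R) (D : {set V}) (phi : V -> V) (psi0 : V -> W) :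
  vertex_spread q mu -> {in D &, injective phi} -> {in D &, injective psi0} ->
  prob mu [pred psi : {ffun V -> W} | [forall x in D, psi (phi x) == psi0 x]]
  <= q ^+ #|D|.
Proof.
move=> [[mu0 _] _ spr] phiI psiI.
pose x := [tuple phi (enum_val i) | i < #|D|].
pose y := [tuple psi0 (enum_val i) | i < #|D|].
have xU : uniq x.
  apply/tuple_uniqP => i j; rewrite !tnth_mktuple => /phiI H.
  by apply: enum_val_inj; apply: H; apply: enum_valP.
have yU : uniq y.
  apply/tuple_uniqP => i j; rewrite !tnth_mktuple => /psiI H.
  by apply: enum_val_inj; apply: H; apply: enum_valP.
apply: le_trans (spr _ x y (max_card _) xU yU); apply: prob_le => // psi /=.
move=> /forall_inP H _; apply/forallP => i; rewrite !tnth_mktuple.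
by apply: H; apply: enum_valP.
Qed.

Definition edge_image (V W : finType) (psi : V -> W) (G : {set {set V}}) :
  {set {set W}} := [set psi @: (e : {set V}) | e in G].

Section CopySpread.

Variables (R : realType) (V W : finType) (k Delta : nat).
Variables (d alpha eps C' : R) (G : {set {set V}}) (mu : {ffun V -> W} -> R).
Hypotheses (k_ge2 : (2 <= k)%N) (d_gt0 : 0 < d) (alpha_gt0 : 0 < alpha).
Hypothesis C'_gt0 : 0 < C'.
Hypotheses (G_unif : uniform k G) (G_deg : (max_degree G <= Delta)%N).
Hypothesis G_degen : degenerate d alpha eps G.
Hypothesis V_gt0 : (0 < #|V|)%N.
Hypothesis mu_spread : vertex_spread (C' / #|V|%:R) mu.

Local Notation n := (#|V|%:R : R).

(** The cost per edge of [F]: the k-th power is for the maps on at most k vertices, 2^(k Delta) for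
    the sets [F] with given roots, and [expR 2] holds one factor e for the large clusters and one
    for the choice of roots. The maximum with 1 lets exponents be raised. *)
Definition copy_spread_const : R :=
  ((k * Delta).+1%:R * Num.max 1 C') ^+ k * 2 ^+ (k * Delta) * expR 2.

Lemma copy_spread_const_gt0 : 0 < copy_spread_const.
Proof.
rewrite /copy_spread_const !mulr_gt0 ?exprn_gt0 ?expR_gt0 //.
by rewrite mulr_gt0 // lt_max ltr01.
Qed.

(** On the covered vertices [phi] is [psi0] followed by the inverse of [psi]: every edge of [F] has
    the same image under [psi0] as some edge of [G] under [psi]. *)
Lemma copy_meets (psi0 : V -> W) (psi : {ffun V -> W}) (S : {set {set V}}) t :
  injective psi0 -> injective psi -> S \subset G ->
  (t <= #|edge_image psi G :&: edge_image psi0 S|)%N ->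
  exists F : {set {set V}}, exists phi : {ffun V -> V},
    [/\ F \subset S, #|F| = t, phi \in homs (coedge F) (coedge G) (cover F),
        {in cover F &, injective phi}
      & {in cover F, forall x, psi (phi x) = psi0 x}].
Proof.
move=> psi0I psiI SG tS.
pose S1 := [set e in S | psi0 @: e \in edge_image psi G].
have S1t : (t <= #|S1|)%N.
  apply: leq_trans tS _; rewrite -(card_imset (mem S1) (imset_inj psi0I)).
  apply: subset_leq_card; apply/subsetP => f; rewrite inE => /andP[fG /imsetP[e eS fE]].
  by apply/imsetP; exists e; rewrite // !inE eS -fE.
have /card_geqP[s [sU st sS1]] := S1t.
pose F : {set {set V}} := [set e in s].
have FS1 : F \subset S1 by apply/subsetP => e; rewrite inE => /sS1.
have FS e : e \in F -> e \in S by move/(subsetP FS1); rewrite inE => /andP[].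
have Fimg e : e \in F -> exists2 g, g \in G & psi0 @: e = psi @: g.
  by move/(subsetP FS1); rewrite inE => /andP[_ /imsetP[g gG ->]]; exists g.
pose phi := [ffun x => if x \in cover F then odflt x [pick z | psi z == psi0 x] else x].
have phiE e x : e \in F -> x \in e -> psi (phi x) = psi0 x.
  move=> eF xe; have xF : x \in cover F by apply/bigcupP; exists e.
  rewrite ffunE xF; case: pickP => [z /eqP//|no].
  have [g gG ge] := Fimg e eF.
  have : psi0 x \in psi @: g by rewrite -ge imset_f.
  by case/imsetP => z _ xz; have := no z; rewrite xz eqxx.
exists F, phi; split.
- by apply/subsetP.
- by rewrite cardsE -st; apply/card_uniqP.
- apply/homsP; split=> [x /negbTE xF|x y _ _ /existsP[e /and3P[eF xe ye]]].
    by rewrite ffunE xF.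
  have [g gG ge] := Fimg e eF; apply/existsP; exists g; rewrite gG /=.
  rewrite -!(mem_imset _ _ psiI) -ge (phiE e) // (phiE e) //.
  by rewrite !imset_f.
- move=> x y /bigcupP[e eF xe] /bigcupP[f fF yf] /(congr1 psi).
  by rewrite (phiE e) // (phiE f) // => /psi0I.
- by move=> x /bigcupP[e eF xe]; apply: (phiE e).
Qed.

Lemma prob_contains_le (F : {set {set V}}) : F \subset G ->
  (#|homs (coedge F) (coedge G) (cover F)|%:R * (C' / n) ^+ #|cover F| : R) <=
  ((k * Delta).+1%:R * Num.max 1 C') ^+ (k * #|F|) *
    n `^ (#|cluster_roots (@edge_adj V) F|%:R - #|cover F|%:R).
Proof.
move=> FG; set c := #|cluster_roots _ F|; set v := #|cover F|.
have n0 : 0 < n by rewrite ltr0n.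
have B1 : 1 <= Num.max 1 C' by rewrite le_max lexx.
have M1 : 1 <= (k * Delta).+1%:R :> R by rewrite ler1n.
have k0 : (0 < k)%N by apply: leq_trans k_ge2.
apply: (@le_trans _ _ ((n ^+ c * (k * Delta).+1%:R ^+ v) * (C' / n) ^+ v)).
  rewrite ler_wpM2r ?exprn_ge0 ?divr_ge0 ?(ltW C'_gt0) //.
  by rewrite -!natrX -natrM ler_nat card_edge_homs.
have nn0 : n != 0 by rewrite gt_eqF.
rewrite powRB ?nn0 ?implybT // !powR_mulrn ?(ltW n0) //.
rewrite expr_div_n.
have -> : n ^+ c * (k * Delta).+1%:R ^+ v * (C' ^+ v / n ^+ v) =
   ((k * Delta).+1%:R * C') ^+ v * (n ^+ c / n ^+ v) by rewrite exprMn [n ^+ c * _]mulrC mulrACA.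
rewrite ler_wpM2r ?divr_ge0 ?exprn_ge0 ?(ltW n0) //.
apply: (@le_trans _ _ (((k * Delta).+1%:R * Num.max 1 C') ^+ v)).
  rewrite lerXn2r ?nnegrE ?mulr_ge0 ?(ltW C'_gt0) ?(le_trans ler01 B1) //.
  by rewrite ler_pM2l ?le_max ?lexx ?orbT.
apply: ler_weXn2l; first by rewrite -[leLHS]mulr1 ler_pM.
exact: (card_cover G_unif FG).
Qed.

(** The bound on |S| makes (1 + n^(-alpha/d))^|S| at most e^t. The alternative deals with large
    clusters: either [S] covers at most eps n vertices and there are none, or the factor n^(alpha
    L/d), with L at most 1/eps, is at most e^t. *)
Lemma prob_copy_meets (psi0 : V -> W) (S : {set {set V}}) (t : nat) :
  injective psi0 -> S \subset G ->
  #|S|%:R <= t%:R * n `^ (alpha / d) ->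
  (k%:R * #|S|%:R <= eps * n) || (n `^ (alpha / (d * eps)) <= expR t%:R) ->
  prob mu [pred psi : {ffun V -> W} |
            (t <= #|edge_image psi G :&: edge_image psi0 S|)%N]
  <= (copy_spread_const / n `^ d^-1) ^+ t.
Proof.
move=> psi0I SG St large; have [[mu0 _] supp _] := mu_spread.
have n1 : 1 <= n by rewrite ler1n.
have n0 : 0 < n by rewrite ltr0n.
have nn0 : n != 0 by rewrite gt_eqF.
have [/andP[eps0 eps1] _ _] := G_degen.
pose J (Fp : {set {set V}} * {ffun V -> V}) := [&& Fp.1 \subset S, #|Fp.1| == t,
  Fp.2 \in homs (coedge Fp.1) (coedge G) (cover Fp.1) & dinjectiveb Fp.2 (cover Fp.1)].
pose Q (Fp : {set {set V}} * {ffun V -> V}) := [pred psi : {ffun V -> W} |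
  [forall x in cover Fp.1, psi (Fp.2 x) == psi0 x]].
apply: (@le_trans _ _ (\sum_(Fp | J Fp) prob mu (Q Fp))).
  apply: sum_le_prob => //.
  move=> psi /supp/injectiveP psiI /= /(copy_meets psi0I psiI SG).
  case=> F [phi [FS Ft phiH phiI phiE]]; exists (F, phi); rewrite /J /=.
    by rewrite FS Ft eqxx phiH; apply/dinjectiveP.
  by apply/forall_inP => x /phiE ->.
pose x := n `^ (- (alpha / d)).
have x0 : 0 <= x by apply: powR_ge0.
pose B := ((k * Delta).+1%:R * Num.max 1 C') ^+ k : R.
have B0 : 0 <= B by rewrite exprn_ge0 // mulr_ge0 // le_max ler01.
pose c (F : {set {set V}}) := #|cluster_roots (@edge_adj V) F|.
apply: (@le_trans _ _ (\sum_(F : {set {set V}} | (F \subset S) && (#|F| == t))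
    B ^+ t * (n `^ (- d^-1)) ^+ t * expR t%:R * x ^+ c F)).
  apply: (@le_trans _ _ (\sum_(F : {set {set V}} | (F \subset S) && (#|F| == t))
      \sum_(phi in homs (coedge F) (coedge G) (cover F)) (C' / n) ^+ #|cover F|)).
    rewrite [leRHS]pair_big_dep /= [leLHS]big_mkcond [leRHS]big_mkcond /=.
    have q0 : 0 <= C' / n by rewrite divr_ge0 ?(ltW C'_gt0).
    apply: ler_sum => -[F phi] _; rewrite /J /= andbA.
    case: ((F \subset S) && _) => //=; case: (phi \in _) => //=.
    case: ifP => [/dinjectiveP phiI|_]; last exact: exprn_ge0.
    by apply: prob_vertex_spread => // y z _ _ /psi0I.
  apply: ler_sum => F /andP[FS /eqP Ft]; rewrite sumr_const -[leLHS]mulr_natl.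
  have FG := subset_trans FS SG.
  apply: le_trans (prob_contains_le FG) _.
  rewrite Ft exprM -!mulrA ler_wpM2l ?(exprn_ge0 _ B0) //.
  have [L [FL Leps L0]] := card_edges_clusters G_unif d_gt0 G_degen k_ge2 FG.
  have nL : n `^ (alpha / d * L%:R) <= expR t%:R.
    case/orP: large => [small|big].
      rewrite L0 ?mulr0 ?powRr0; first by rewrite -[leLHS]expR0 ler_expR.
      apply: le_trans small; rewrite -natrM ler_nat.
      apply: leq_trans (card_cover G_unif FG) _.
      by rewrite leq_mul2l subset_leq_card ?orbT.
    apply: le_trans big; apply: ler_powR => //.
    by rewrite invfM mulrA ler_wpM2l // divr_ge0 ?(ltW d_gt0) ?(ltW alpha_gt0).
  (* The density inequality of [card_edges_clusters], divided by d, bounds the exponent. *)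
  apply: (@le_trans _ _ (n `^ (- d^-1 * t%:R + (alpha / d * L%:R - alpha / d * (c F)%:R)))).
    apply: ler_powR => //; rewrite -/(c F).
    rewrite -(ler_pM2l d_gt0).
    have -> : d * (- d^-1 * t%:R + (alpha / d * L%:R - alpha / d * (c F)%:R)) =
       - t%:R + alpha * L%:R - alpha * (c F)%:R.
      by move: L%:R (c F)%:R t%:R (gt_eqF d_gt0) => L' c' t' dn0; field; rewrite dn0.
    move: FL; rewrite Ft -/(c F).
    by move: L%:R (c F)%:R t%:R #|cover F|%:R => L' c' t' v'; lra.
  rewrite powRD ?nn0 ?implybT // powRrM powR_mulrn ?powR_ge0 //.
  rewrite ler_wpM2l ?exprn_ge0 ?powR_ge0 //.
  have xc : n `^ (- (alpha / d * (c F)%:R)) = x ^+ c F.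
    by rewrite -mulNr powRrM powR_mulrn ?powR_ge0.
  by rewrite powRD ?nn0 ?implybT // xc ler_wpM2r ?exprn_ge0.
rewrite -mulr_sumr.
have k0 : (0 < k)%N by apply: leq_trans k_ge2.
have := sum_expr_cluster_roots (@edge_adjC V) (edge_adj_refl k0 G_unif SG)
  (edge_adj_deg G_unif G_deg SG) t x0.
set s := \sum_(F | _) _ => sle.
have sexp : s <= (2 ^+ (k * Delta)) ^+ t * expR t%:R.
  apply: le_trans sle _; rewrite -exprM ler_wpM2l ?exprn_ge0 //.
  (* Here [1 + x <= expR x], and [x * #|S|] is at most t. *)
  apply: (@le_trans _ _ (expR x ^+ #|S|)).
    by rewrite lerXn2r ?nnegrE ?addr_ge0 ?expR_ge0 ?expR_ge1Dx.
  rewrite -expRM_natl ler_expR /x powRN.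
  by rewrite ler_pdivrMr ?powR_gt0.
apply: le_trans (ler_wpM2l _ sexp) _.
  by rewrite !mulr_ge0 ?(exprn_ge0 _ B0) ?exprn_ge0 ?powR_ge0 ?expR_ge0.
rewrite /copy_spread_const -/B powRN !exprMn.
have -> : expR 2 ^+ t = expR t%:R * expR t%:R :> R.
  by rewrite -expRD -expRM_natl; congr expR; ring.
have shuffle (b y z e : R) : b * y * e * (z * e) = b * z * (e * e) * y by ring.
by rewrite shuffle exprVn.
Qed.

End CopySpread.

Lemma copiesP (V W : finType) (G : {set {set V}}) (H A : {set {set W}}) :
  reflect (exists psi : {ffun V -> W}, [/\ injective psi, A = edge_image psi G & A \subset H])
          (A \in copies G H).
Proof.
rewrite inE; apply: (iffP existsP) => [[U /andP[/andP[AH _] /existsP[psi]]]|].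
  by case/and3P => /injectiveP psiI _ /eqP AE; exists psi.
case=> psi [psiI AE AH]; exists (psi @: [set: V]); rewrite /subgraph /= AH /=.
apply/andP; split.
  rewrite AE; apply/forall_inP => _ /imsetP[e _ ->]; apply: imsetS; exact: subsetT.
by apply/existsP; exists psi; rewrite eqxx AE eqxx !andbT; apply/injectiveP.
Qed.

(** * Growth of powers of n *)

Section Asymptotics.

Variable R : realType.

Lemma natr_powR_ge (a B : R) : 0 < a ->
  exists n0 : nat, forall n, (n0 <= n)%N -> B <= n%:R `^ a.
Proof.
move=> a0; pose B1 := Num.max 1 B.
have B10 : 0 <= B1 by rewrite le_max ler01.
have a_neq0 : a != 0 by rewrite gt_eqF.
exists (Num.bound (B1 `^ a^-1)) => n n0n.
apply: (@le_trans _ _ B1); first by rewrite le_max lexx orbT.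
have -> : B1 = (B1 `^ a^-1) `^ a by rewrite -powRrM mulVf ?powRr1.
apply: ge0_ler_powR; rewrite ?nnegrE ?powR_ge0 //; first exact: ltW.
apply: le_trans (ltW (archi_boundP (powR_ge0 _ _))) _.
by rewrite ler_nat.
Qed.

Lemma natr_powR_le_expR (a b : R) : 0 < a -> 0 < b ->
  exists n0 : nat, forall n, (n0 <= n)%N -> n%:R `^ a <= expR (b * n%:R).
Proof.
move=> a0 b0; have h0 : 0 < 2^-1 :> R by rewrite invr_gt0.
have [n0 H] := natr_powR_ge (2 * a / b) h0.
exists n0.+1 => n n0n; have np : 0 < n%:R :> R by rewrite ltr0n (leq_trans _ n0n).
rewrite -[leLHS]lnK ?posrE ?powR_gt0 // ler_expR ln_powR.
(* With s the square root of n, ln n = 2 ln s is at most 2 s, so [2 * a / b <= s] suffices. *)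
pose s := n%:R `^ 2^-1 : R.
have s0 : 0 < s by apply: powR_gt0.
have ss : s * s = n%:R.
  rewrite -powRD ?(gt_eqF np) ?implybT //.
  by rewrite (_ : 2^-1 + 2^-1 = 1) ?powRr1 ?(ltW np) //; field.
have := H n (ltnW n0n); rewrite -/s ler_pdivrMr // => abs.
have ln_s : ln n%:R <= 2 * s.
  by rewrite -ss lnM ?posrE //; have := ln_sublinear s0; lra.
apply: le_trans (ler_wpM2l (ltW a0) ln_s) _; rewrite -ss.
have -> : b * (s * s) = s * b * s by ring.
have -> : a * (2 * s) = 2 * a * s by ring.
by rewrite ler_pM2r.
Qed.

End Asymptotics.

Section PushForward.

Variables (R : realType) (V W : finType) (G : {set {set V}}) (mu : {ffun V -> W} -> R).

Definition copy_distr (A : {set {set W}}) : R :=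
  \sum_(psi : {ffun V -> W} | edge_image psi G == A) mu psi.

Lemma prob_copy_distr (P : pred {set {set W}}) :
  prob copy_distr P = prob mu [pred psi : {ffun V -> W} | P (edge_image psi G)].
Proof.
rewrite /prob /copy_distr [RHS](partition_big (fun psi : {ffun V -> W} => edge_image psi G) P) //=.
apply: eq_bigr => A PA; apply: eq_bigl => psi.
by have [->|_] := eqVneq (edge_image psi G) A; rewrite ?PA ?andbF.
Qed.

Lemma copy_distrP H q : vertex_spread q mu -> supported mu (embedding G H) ->
  distribution copy_distr /\ supported copy_distr (fun A => A \in copies G H).
Proof.
move=> [[mu0 mu1] _ _] supp; split.
  split=> [A|]; first exact: sumr_ge0.
  by rewrite -[LHS]/(prob copy_distr predT) prob_copy_distr.
move=> A nz; suff /existsP[psi /andP[/eqP AE mupsi]] :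
    [exists psi : {ffun V -> W}, (edge_image psi G == A) && (mu psi != 0)].
  have /andP[/injectiveP psiI /forall_inP psiH] := supp psi mupsi.
  apply/copiesP; exists psi; split=> //; rewrite -AE.
  by apply/subsetP => _ /imsetP[e eG ->]; apply: psiH.
apply: contraNT nz => /existsPn no; apply/eqP/big1 => psi AE; apply/eqP.
by have := no psi; rewrite AE /= negbK.
Qed.

End PushForward.

(** The bound [L] on the number of steps is independent of n, as the threshold needs. *)
Lemma copies_spread (R : realType) (k Delta : nat) (d alpha C' eps : R) :
  (2 <= k)%N -> 0 < d -> 0 < alpha -> 0 < C' ->
  exists n0 L : nat, forall n, (n0 <= n)%N ->
    forall (V W : finType) (G : {set {set V}}) (H : {set {set W}}),
    #|V| = n -> uniform k G -> degenerate d alpha eps G ->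
    (max_degree G <= Delta)%N -> eps / k%:R < d ->
    (exists mu : {ffun V -> W} -> R,
       vertex_spread (C' / n%:R) mu /\ supported mu (embedding G H)) ->
    exists (l : nat) (r : nat -> R) (mu' : {set {set W}} -> R),
      [/\ (0 < l <= L)%N,
          r 0%N = d * n%:R,
          r 1%N = eps * n%:R / k%:R,
          (forall i, (2 <= i <= l.-1)%N ->
             r i = r i.-1 / n%:R `^ (9%:R * alpha / (10%:R * d))) /\
          r l = 1
        & spread (copy_spread_const k Delta C' / n%:R `^ d^-1) l r (copies G H) mu'].
Proof.
move=> k2 d0 alpha0 C'0; set C := copy_spread_const k Delta C'.
have [eps0|eps_le0] := ltP 0 eps; last first.
  by exists 0%N, 0%N => n _ V W G H _ _ [/andP[]]; rewrite ltNge eps_le0.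
have k0 : 0 < k%:R :> R by rewrite ltr0n (leq_trans _ k2).
have C0 : 0 < C by apply: copy_spread_const_gt0.
pose delta : R := 9%:R * alpha / (10%:R * d).
have delta0 : 0 < delta by rewrite divr_gt0 ?mulr_gt0.
have deltaE : delta <= alpha / d.
  have -> : delta = 9 / 10 * (alpha / d) by rewrite /delta; field; rewrite gt_eqF.
  by rewrite -[leRHS]mul1r ler_wpM2r ?divr_ge0 ?(ltW d0) ?(ltW alpha0) //; lra.
(* The five bounds on n ensure in turn: spread parameter at most 1; n^(alpha/(d eps)) at most e^(r
   1); r 0 at most r 1 n^(alpha/d); r 1 above 1; ratio n^delta at least 2. *)
have [n1 H1] := @natr_powR_ge R d^-1 C (eq_trans (invr_gt0 d) d0).
have ad0 : 0 < alpha / d by rewrite divr_gt0.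
have ade0 : 0 < alpha / (d * eps) by rewrite divr_gt0 ?mulr_gt0.
have ek0 : 0 < eps / k%:R by rewrite divr_gt0.
have [n2 H2] := natr_powR_le_expR ade0 ek0.
have [n3 H3] := natr_powR_ge (d * k%:R / eps) ad0.
have [n4 H4] := natr_powR_ge (2 * k%:R / eps) (@ltr01 R).
have [n5 H5] := natr_powR_ge 2 delta0.
(* As [m] exceeds 1/delta, dividing r 1, which is at most n, by n^delta [m] times gives at most
   1. *)
pose m := Num.bound delta^-1.
exists (n1 + n2 + n3 + n4 + n5 + 2)%N, m.+1 => n n0n V W G H Vn uG degG mdG epsd [mu [mus muH]].
have ni i : (i <= n1 + n2 + n3 + n4 + n5 + 2)%N -> (i <= n)%N by move=> /leq_trans; apply.
have n1n : (n1 <= n)%N by apply: ni; rewrite -!addnA leq_addr.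
have n2n : (n2 <= n)%N by apply: ni; rewrite [(n1 + n2)%N]addnC -!addnA leq_addr.
have n3n : (n3 <= n)%N by apply: ni; rewrite [(_ + n3)%N]addnC -!addnA leq_addr.
have n4n : (n4 <= n)%N by apply: ni; rewrite [(_ + n4)%N]addnC -!addnA leq_addr.
have n5n : (n5 <= n)%N by apply: ni; rewrite [(_ + n5)%N]addnC -!addnA leq_addr.
have n_ge2 : (2 <= n)%N by apply: ni; rewrite addnC leq_addr.
have {H1}qC := H1 n n1n; have {H2}h2 := H2 n n2n; have {H3}h3 := H3 n n3n.
have {H4}h4 := H4 n n4n; have {H5}h5 := H5 n n5n.
have np : 0 < n%:R :> R by rewrite ltr0n (leq_trans _ n_ge2).
rewrite powRr1 ?(ltW np) // in h4.
set x := n%:R `^ delta in h5 *; have x0 : 0 < x by apply: powR_gt0.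
pose rho i : R := eps * n%:R / k%:R / x ^+ i.-1.
have rho1 : rho 1%N = eps * n%:R / k%:R by rewrite /rho expr0 divr1.
have rhoS i : (0 < i)%N -> rho i.+1 = rho i / x.
  by case: i => // i _; rewrite /rho /= exprSr invfM mulrA.
have rho1_gt1 : 1 < rho 1%N.
  rewrite rho1 ltr_pdivlMr // mul1r.
  by move: h4; rewrite ler_pdivrMr // => h4; lra.
have rho_dec i : (0 < i)%N -> rho i.+1 <= rho i.
  move=> i0; rewrite rhoS // ler_pdivrMr // ler_peMr //; last by lra.
  by rewrite /rho !mulr_ge0 ?invr_ge0 ?exprn_ge0 ?(ltW np) ?(ltW k0) ?(ltW x0) ?(ltW eps0).
have rho_le1 i : (0 < i)%N -> rho i <= rho 1%N.
  elim: i => // -[//|i] IH _; apply: le_trans (IH isT); exact: rho_dec.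
have [/andP[_ eps1] _ _] := degG.
have k1 : 1 <= k%:R :> R by rewrite ler1n (leq_trans _ k2).
have rhom : (0 < m.+1)%N && (rho m.+1 <= 1).
  rewrite /= ler_pdivrMr ?exprn_gt0 // mul1r.
  apply: (@le_trans _ _ n%:R).
    rewrite mulrAC ler_piMl ?(ltW np) // ler_pdivrMr // mul1r.
    exact: le_trans (ltW eps1) k1.
  rewrite -powR_mulrn ?(ltW x0) // -powRrM -[leLHS]powRr1 ?(ltW np) //.
  apply: ler_powR; first by rewrite ler1n (leq_trans _ n_ge2).
  have dV0 : 0 <= delta^-1 by rewrite invr_ge0 (ltW delta0).
  rewrite mulrC -ler_pdivrMr // div1r.
  exact: ltW (archi_boundP dV0).
have exl : exists i, (0 < i)%N && (rho i <= 1) by exists m.+1.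
(* [l] is the first index at which the geometric sequence is at most 1; there [r] takes the value 1
   instead. *)
have [l /andP[l0 rhol] lmin] := ex_minnP exl.
have l2 : (1 < l)%N.
  by case: l l0 rhol {lmin} => [|[|l]] // _; rewrite leNgt rho1_gt1.
have rho_gt1 i : (0 < i < l)%N -> 1 < rho i.
  move=> /andP[i0 il]; rewrite ltNge; apply/negP => rhoi.
  by have := lmin i; rewrite i0 rhoi leqNgt il => /(_ isT).
pose r i : R := if i == 0%N then d * n%:R else if i == l then 1 else rho i.
have r0 : r 0%N = d * n%:R by [].
have rE i : (0 < i < l)%N -> r i = rho i.
  by move=> /andP[i0 il]; rewrite /r gtn_eqF // ltn_eqF.
have rl : r l = 1 by rewrite /r gtn_eqF // eqxx.
have r1 : r 1%N = eps * n%:R / k%:R by rewrite rE // l2.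
have rho_r i : (0 < i <= l)%N -> rho i <= r i.
  move=> /andP[i0]; rewrite leq_eqVlt => /orP[/eqP->|il]; first by rewrite rl.
  by rewrite rE // i0.
have r_gt0 i : (0 < i <= l)%N -> 0 < r i.
  move=> /andP[i0]; rewrite leq_eqVlt => /orP[/eqP->|il]; first by rewrite rl ltr01.
  by rewrite rE ?i0 //; apply: lt_trans ltr01 (rho_gt1 _ _); rewrite i0.
have V0 : (0 < #|V|)%N by rewrite Vn (leq_trans _ n_ge2).
have mus' : vertex_spread (C' / #|V|%:R) mu by rewrite Vn.
have q0 : 0 < C / n%:R `^ d^-1 by rewrite divr_gt0 ?powR_gt0.
have q1 : C / n%:R `^ d^-1 <= 1 by rewrite ler_pdivrMr ?mul1r ?powR_gt0.
have [mu'D mu'S] := copy_distrP mus muH.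
have mu0 : forall psi, 0 <= mu psi by case: mus => -[].
exists l, r, (copy_distr G mu); split=> //.
- by rewrite l0; apply: lmin.
- split=> // i /andP[i2 il].
  have il' : (i < l)%N by rewrite -ltnS prednK in il.
  have i1 : (0 < i.-1)%N by rewrite -ltnS prednK // (leq_trans _ i2).
  rewrite !rE ?(leq_trans _ i2) // ?i1 ?(leq_ltn_trans (leq_pred i)) //.
  by rewrite -rhoS // prednK // (leq_trans _ i2).
split.
- by rewrite q1 ltW.
- move=> [|i] il.
    by rewrite r0 r1 mulrAC ltr_pM2r.
  rewrite [ltRHS]rE; last exact: il.
  have /orP[/eqP ->|il2] : (i.+2 == l) || (i.+2 < l)%N by rewrite -leq_eqVlt.
    by rewrite rl; apply: rho_gt1.
  rewrite rE ?il2 // rhoS // ltr_pdivrMr // ltr_pMr; first by lra.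
  exact: lt_trans ltr01 (rho_gt1 i.+1 il).
- move=> _ /copiesP[psi [psiI -> _]]; rewrite card_imset; last exact: imset_inj.
  apply: (@le_trans _ _ (d * (#|[set: V]|%:R - 1))).
    apply: (card_edges_m1 degG); last by rewrite cardsT Vn.
    by rewrite /subgraph /= subxx; apply/forall_inP => e _; apply: subsetT.
  by rewrite r0 cardsT Vn ler_pM2l // gerBl.
- by [].
move=> i /andP[i0 il] t /andP[rit tri] _ S /copiesP[psi0 [psi0I -> _]] SA /andP[riS Sri].
pose S0 := [set e in G | psi0 @: e \in S].
have S0G : S0 \subset G by apply/subsetP => e; rewrite inE => /andP[].
have SE : S = edge_image psi0 S0.
  apply/setP => f; apply/idP/imsetP => [fS|[e + ->]]; last by rewrite inE => /andP[].
  by have /imsetP[e eG fE] := subsetP SA f fS; exists e; rewrite // inE eG -fE.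
have cardS : #|S| = #|S0| by rewrite SE card_imset //; apply: imset_inj.
have t0 : 0 < t by apply: lt_le_trans rit; apply: r_gt0; rewrite i0.
have exj : exists j : nat, t <= j%:R.
  by exists (Num.bound t); apply: ltW; apply: archi_boundP; apply: ltW.
(* [j] is the ceiling of t: a size at least t is at least [j], and q^j <= q^t because q <= 1. *)
have [j tj jmin] := ex_minnP exj.
apply: (@le_trans _ _ ((C / n%:R `^ d^-1) ^+ j)); last first.
  by rewrite -powR_mulrn ?(ltW q0) // ger_powR // q0.
rewrite prob_copy_distr.
apply: (@le_trans _ _ (prob mu [pred psi : {ffun V -> W} |
            (j <= #|edge_image psi G :&: edge_image psi0 S0|)%N])).
  by apply: prob_le => // psi /= tS _; rewrite -SE; apply: jmin.
rewrite -Vn; apply: (prob_copy_meets (d := d) (alpha := alpha) (eps := eps)) => //; rewrite Vn.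
(* For i = 1 this is r 0 <= r 1 n^(alpha/d); for later i, r (i-1) = [rho i * x], where [rho i] is at
   most t and delta at most alpha/d. *)
- rewrite -cardS; apply: (le_trans Sri).
  case: i i0 il rit {tri riS Sri} => // -[|i] _ il rit /=.
    rewrite r0; apply: (@le_trans _ _ (r 1%N * n%:R `^ (alpha / d))).
      rewrite r1; apply: le_trans (ler_wpM2l _ h3); last first.
        by rewrite divr_ge0 ?mulr_ge0 ?(ltW eps0) ?(ltW np) ?(ltW k0).
      have -> : eps * n%:R / k%:R * (d * k%:R / eps) = d * n%:R; last exact: lexx.
      by move: n%:R k%:R k0 => n' k' k0; field; rewrite !gt_eqF.
    by rewrite ler_wpM2r ?powR_ge0 // (le_trans rit).
  rewrite rE //.
  have -> : rho i.+1 = rho i.+2 * x by rewrite [rho i.+2]rhoS // divfK // gt_eqF.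
  apply: ler_pM; rewrite ?(ltW x0) //.
  + by rewrite /rho !mulr_ge0 ?invr_ge0 ?exprn_ge0 ?(ltW np) ?(ltW k0) ?(ltW x0) ?(ltW eps0).
  + by apply: le_trans tj; apply: le_trans rit; apply: rho_r; rewrite il.
  + by apply: ler_powR => //; rewrite ler1n (leq_trans _ n_ge2).
(* For i = 1, t >= eps n / k and e^t absorbs the large clusters; for later i, |S| <= r 1 = eps n / k
   rules them out. *)
- case: i i0 il rit {tri riS} Sri => // -[|i] _ il rit /= Sri; apply/orP.
    right; apply: (le_trans h2); rewrite ler_expR mulrAC; apply: le_trans tj.
    by rewrite -r1.
  left; rewrite -cardS; move: Sri; rewrite rE //.
  move=> Sri; have := le_trans Sri (rho_le1 i.+1 isT).
  by rewrite rho1 ler_pdivlMr // mulrC.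
Qed.

(** * The threshold *)

Section UniformInjections.

Variables (V W : finType).
Hypothesis VW : #|V| = #|W|.

Definition extensions (x : seq V) (y : seq W) : {set {ffun V -> W}} :=
  [set psi : {ffun V -> W} | injectiveb psi & map psi x == y].

(** Composing with the transposition of [b] and [b'] fixes the values in [y] and carries one set of
    extensions into the other. *)
Lemma card_extensions_le a x b b' y :
  uniq (b :: y) -> uniq (b' :: y) ->
  (#|extensions (a :: x) (b :: y)| <= #|extensions (a :: x) (b' :: y)|)%N.
Proof.
move=> /= /andP[by_ _] /andP[b'y _].
pose f (psi : {ffun V -> W}) := [ffun v => tperm b b' (psi v)].
have fI : injective f.
  move=> psi psi' /ffunP E; apply/ffunP => v.
  by have := E v; rewrite !ffunE => /perm_inj.
rewrite -(card_imset _ fI); apply: subset_leq_card; apply/subsetP => _ /imsetP[psi + ->].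
rewrite !inE => /andP[/injectiveP psiI /= /eqP[ab xy]]; apply/andP; split.
  by apply/injectiveP => u v; rewrite !ffunE => /perm_inj/psiI.
rewrite ffunE ab tpermL; apply/eqP; congr (_ :: _); rewrite -[RHS]xy.
apply/eq_in_map => v vx; rewrite ffunE tpermD //.
  by apply: contraNneq by_ => ->; rewrite -xy map_f.
by apply: contraNneq b'y => ->; rewrite -xy map_f.
Qed.

(** All [#|W| - size x] values available to a further point allow equally many extensions. *)
Lemma card_extensions x y : uniq x -> uniq y -> size x = size y ->
  (#|extensions x y| * #|W| ^_ (size x) <= #|W|`!)%N.
Proof.
elim: x y => [|a x IH] [|b y] //=.
  move=> _ _ _; rewrite ffactn0 muln1 -ffactnn -{2}VW -card_inj_ffuns.
  by apply: subset_leq_card; apply/subsetP => psi; rewrite !inE => /andP[].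
move=> /andP[_ xU] byU [sxy]; have yU : uniq y by case/andP: byU.
rewrite ffactnSr mulnA mulnAC; apply: leq_trans (IH y xU yU sxy).
rewrite leq_mul2r; apply/orP; right.
have cardy : #|[predC y]| = (#|W| - size x)%N.
  by rewrite -(cardC (mem y)) (card_uniqP yU) sxy addKn.
rewrite -cardy mulnC -sum_nat_const.
apply: (@leq_trans (\sum_(b' in [predC y]) #|extensions (a :: x) (b' :: y)|)%N).
  by apply: leq_sum => b' b'y; apply: card_extensions_le; rewrite //= yU andbT.
rewrite -[leqRHS]sum1_card (partition_big (fun psi : {ffun V -> W} => psi a) predT) //=.
rewrite [leqLHS]big_mkcond /=; apply: leq_sum => b' _; case: ifP => // _.
rewrite -sum1_card [leqLHS]big_mkcond [leqRHS]big_mkcond /=; apply: leq_sum => psi _.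
rewrite !inE /= eqseq_cons; case: (injectiveb psi) => //=.
by case: (psi a == b'); case: (_ == y).
Qed.

Variable R : realType.

(** In the induction step from m to m + 1, the ratio (1 + 1/m)^s is at most e^(s/m), hence at most e
    as s <= m. *)
Lemma expn_le_ffact n s : (s <= n)%N ->
  n%:R ^+ s <= expR 1 ^+ s * (n ^_ s)%:R :> R.
Proof.
elim: s n => [|s IH] [|m] // sm; first by rewrite !expr0 mul1r.
  by rewrite !expr0 mul1r.
rewrite ffactSS natrM !exprS mulrCA ler_wpM2l //.
rewrite -mulrA.
have [m0|m0] := posnP m.
  move: sm; rewrite m0 ltnS leqn0 => /eqP ->.
  by rewrite !expr0 ffactn0 !mulr1 -[leLHS]expR0 ler_expR.
have mR : 0 < m%:R :> R by rewrite ltr0n.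
apply: (@le_trans _ _ (expR 1 * m%:R ^+ s)); last first.
  by rewrite ler_pM2l ?expR_gt0 // IH.
have -> : m.+1%:R = (1 + m%:R^-1) * m%:R :> R.
  by rewrite mulrDl mul1r mulVf ?gt_eqF // -[LHS]natr1 addrC.
rewrite exprMn ler_pM2r ?exprn_gt0 //.
apply: (@le_trans _ _ (expR (m%:R^-1) ^+ s)).
  by rewrite lerXn2r ?nnegrE ?addr_ge0 ?invr_ge0 ?expR_ge0 ?expR_ge1Dx.
by rewrite -expRM_natl ler_expR ler_pdivrMr // mul1r ler_nat.
Qed.

Definition uniform_injection (psi : {ffun V -> W}) : R :=
  if injectiveb psi then (#|W|`!%:R)^-1 else 0.

(** Prescribing s values has probability at most the inverse of the falling factorial of n, which is
    at most (e/n)^s. *)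
Lemma uniform_injection_spread : vertex_spread (expR 1 / #|V|%:R) uniform_injection.
Proof.
have f0 : 0 < #|W|`!%:R :> R by rewrite ltr0n fact_gt0.
have fI0 : 0 <= (#|W|`!%:R)^-1 :> R by rewrite invr_ge0.
split.
- split=> [psi|]; first by rewrite /uniform_injection; case: ifP.
  rewrite -big_mkcond /= sumr_const -[LHS]mulr_natl.
  have -> : #|[pred psi : {ffun V -> W} | injectiveb psi]| = #|W|`!.
    rewrite -ffactnn -[X in (_ ^_ X)%N]VW -card_inj_ffuns.
    by apply: eq_card => psi; rewrite inE.
  by rewrite mulfV ?gt_eqF.
- by move=> psi; rewrite /uniform_injection; case: ifP; rewrite ?eqxx.
move=> s x y sV xU yU.
have s_ffact : 0 < (#|V| ^_ s)%:R :> R by rewrite ltr0n ffact_gt0.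
apply: (@le_trans _ _ (#|extensions x y|%:R / #|W|`!%:R)).
  rewrite mulrC mulr_natr -sumr_const /prob [leLHS]big_mkcond [leRHS]big_mkcond /=.
  apply: ler_sum => psi _; rewrite /uniform_injection inE.
  case: ifP => [/forallP xy|_]; last by case: ifP.
  case: (injectiveb psi) => //=; suff -> : map psi x == y by [].
  apply/eqP; rewrite -[LHS]/(val (map_tuple psi x)); congr val.
  by apply: eq_from_tnth => i; rewrite tnth_map; apply/eqP.
rewrite ler_pdivrMr //; have := card_extensions xU yU; rewrite !size_tuple => /(_ erefl).
rewrite -(ler_nat R) natrM -VW => ext_le.
rewrite -(ler_pM2r s_ffact); apply: le_trans ext_le _.
rewrite mulrAC; rewrite -[leLHS]mul1r ler_wpM2r //.
rewrite expr_div_n mulrAC.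
have [s0|s0] := posnP s; first by rewrite s0 !expr0 ffactn0 !mul1r invr1.
have V0 : 0 < #|V|%:R :> R by rewrite ltr0n (leq_trans s0).
by rewrite ler_pdivlMr ?exprn_gt0 // mul1r expn_le_ffact.
Qed.

End UniformInjections.

(** * Copies in the random hypergraph *)

Section Threshold.

Variable R : realType.

Lemma random_hypergraphE (k n : nat) (p : R) (E : {set {set 'I_n}}) :
  random_hypergraph k p E =
  bern (fun e => if e \in [set e : {set 'I_n} | #|e| == k] then p else 0) E.
Proof.
rewrite bern_const card_draws card_ord /random_hypergraph.
congr (if _ then _ else _); apply/forall_inP/subsetP => H e /H; by rewrite inE.
Qed.

Lemma embedding_complete (V W : finType) k (G : {set {set V}}) (psi : {ffun V -> W}) :
  uniform k G -> injectiveb psi -> embedding G [set e : {set W} | #|e| == k] psi.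
Proof.
move=> /forall_inP uG psiI; rewrite /embedding psiI /=; apply/forall_inP => e eG.
by rewrite inE card_imset ?uG //; apply/injectiveP.
Qed.

Lemma copies_set0 (n : nat) (V : finType) (E : {set {set 'I_n}}) :
  #|V| = n -> copies (set0 : {set {set V}}) E != set0.
Proof.
move=> Vn; apply/set0Pn; exists set0; apply/copiesP.
exists [ffun v => cast_ord Vn (enum_rank v)]; split; last exact: sub0set.
  by move=> u v; rewrite !ffunE => /cast_ord_inj/enum_rank_inj.
by rewrite /edge_image imset0.
Qed.

(** Here [H] is the complete hypergraph and [mu] the uniform injection, so [C'] is e. The failure
    probability is at most 4 l^2 q / p with q = C / n^(1/d). *)
Lemma prob_random_hypergraph_copy (k Delta : nat) (d alpha eps : R) :
  (2 <= k)%N -> 0 < d -> 0 < alpha ->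
  exists (n0 : nat) (K : R), forall (V : finType) (G : {set {set V}}) (p : R),
    (n0 <= #|V|)%N -> uniform k G -> degenerate d alpha eps G ->
    (max_degree G <= Delta)%N -> 0 < p <= 1 ->
    1 - K / (p * #|V|%:R `^ d^-1) <=
    prob (random_hypergraph k p) [pred E : {set {set 'I_#|V|}} | copies G E != set0] <= 1.
Proof.
move=> k2 d0 alpha0.
have [n0 [L H]] := copies_spread Delta eps k2 d0 alpha0 (expR_gt0 (1 : R)).
pose C : R := copy_spread_const k Delta (expR 1).
have C0 : 0 < C by apply: copy_spread_const_gt0.
exists n0.+1, (4 * L%:R ^+ 2 * C) => V G p nV uG degG mdG p01.
have /andP[p0 p1] := p01.
have n_gt0 : (0 < #|V|)%N by apply: leq_trans nV.
have y0 : 0 < #|V|%:R `^ d^-1 :> R by rewrite powR_gt0 // ltr0n.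
pose HK := [set e : {set 'I_#|V|} | #|e| == k].
pose w := bern (fun e => if e \in HK then p else 0).
have w0 W : 0 <= w W by apply: bern_ge0 => e; rewrite bern_const01 // p1 ltW.
have probE : prob (random_hypergraph k p)
      [pred E : {set {set 'I_#|V|}} | copies G E != set0] =
    \sum_(E | copies G E != set0) w E.
  by apply: eq_bigr => E _; rewrite random_hypergraphE.
have total : \sum_(E | copies G E != set0) w E + \sum_(E | ~~ (copies G E != set0)) w E = 1.
  rewrite -(sum_bern (fun e => if e \in HK then p else 0)).
  by rewrite [RHS](bigID (fun E => copies G E != set0)).
have miss0 : 0 <= \sum_(E | ~~ (copies G E != set0)) w E by apply: sumr_ge0.
rewrite probE; apply/andP; split; last by rewrite -total lerDl.
suff miss : \sum_(E | ~~ (copies G E != set0)) w E <=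
    4 * L%:R ^+ 2 * C / (p * #|V|%:R `^ d^-1).
  by rewrite lerBlDr -[leLHS]total lerD2l.
have K0 : 0 <= 4 * L%:R ^+ 2 * C / (p * #|V|%:R `^ d^-1).
  by rewrite divr_ge0 ?(mulr_ge0 (ltW p0) (ltW y0)) // mulr_ge0 ?(ltW C0) // mulr_ge0 // exprn_ge0.
(* Without edges r 1 < r 0 may fail, but then every hypergraph on n vertices contains a copy. *)
have [G0|GN0] := eqVneq G set0.
  by rewrite big_pred0 // => E; rewrite G0 copies_set0.
have epsd : eps / k%:R < d by apply: (degenerate_ltr_d k2 uG degG GN0).
have [|l [r [mu' [/andP[l0 lL] _ _ [_ rl] spr]]]] :=
    H #|V| (ltnW nV) V 'I_#|V| G HK erefl uG degG mdG epsd.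
  have VI : #|V| = #|'I_#|V| | by rewrite card_ord.
  have uis := uniform_injection_spread VI R.
  exists (uniform_injection R); split=> //.
  have [_ supp _] := uis.
  by move=> psi /supp; apply: embedding_complete.
have copyK A : A \in copies G HK -> A \subset HK by case/copiesP => psi [].
have := no_hit_spread l0 rl spr copyK p01.
rewrite -/w -/C => nohit.
apply: (@le_trans _ _ (l%:R * (2 * (2 * (C / #|V|%:R `^ d^-1) / (p / l%:R))))).
  apply: le_trans nohit; rewrite [leLHS]big_mkcond /=; apply: ler_sum => E _.
  case: ifP => [/negPn/eqP noE|_]; last by rewrite mulr_ge0.
  suff -> : ~~ [exists A, (A \in copies G HK) && (A \subset E)] by rewrite mulr1.
  apply/existsP => -[A /andP[/copiesP[psi [psiI AE _]] AsubE]].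
  have : A \in copies G E by apply/copiesP; exists psi.
  by rewrite noE inE.
have -> : l%:R * (2 * (2 * (C / #|V|%:R `^ d^-1) / (p / l%:R))) =
    4 * l%:R ^+ 2 * C / (p * #|V|%:R `^ d^-1).
  have lR : l%:R != 0 :> R by rewrite pnatr_eq0 -lt0n.
  move: (#|V|%:R `^ d^-1) (l%:R : R) lR y0 => y l' l'0 y0.
  by field; rewrite l'0 !gt_eqF.
rewrite ler_wpM2r ?invr_ge0 ?mulr_ge0 ?(ltW p0) ?(ltW y0) //.
rewrite ler_wpM2r ?(ltW C0) // ler_wpM2l //.
by rewrite lerXn2r ?nnegrE // ler_nat.
Qed.

End Threshold.

Theorem theorem2p6 (R : realType) (k Delta : nat) (d alpha C' : R)
    (hk : (2 <= k)%N) (hd : 0 < d) (halpha : 0 < alpha) (hC' : 0 < C') :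
  (exists C : R, 0 < C /\
     forall eps : R, exists n0 : nat, forall n : nat, (n0 <= n)%N ->
     forall (V W : finType) (G : {set {set V}}) (H : {set {set W}}),
       #|V| = n -> #|W| = n -> uniform k G -> uniform k H ->
       degenerate d alpha eps G -> (max_degree G <= Delta)%N ->
       (* the sequence below has r 1 < r 0; automatic if G has an edge *)
       eps / k%:R < d ->
       (exists mu : {ffun V -> W} -> R,
          vertex_spread (C' / n%:R) mu /\ supported mu (embedding G H)) ->
       exists (l : nat) (r : nat -> R) (mu' : {set {set W}} -> R),
         [/\ (0 < l)%N,
             r 0%N = d * n%:R,
             r 1%N = eps * n%:R / k%:R,
             (forall i, (2 <= i <= l.-1)%N ->
                r i = r i.-1 / n%:R `^ (9%:R * alpha / (10%:R * d))) /\
             r l = 1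
           & spread (C / n%:R `^ d^-1) l r (copies G H) mu'])
  /\
  (forall (eps : R) (V : nat -> finType) (G : forall m, {set {set V m}})
      (p : nat -> R),
     (#|V m| @[m --> \oo] --> \oo) ->
     (forall m, [/\ uniform k (G m), degenerate d alpha eps (G m),
                    (max_degree (G m) <= Delta)%N & 0 <= p m <= 1]) ->
     (p m * #|V m|%:R `^ d^-1 @[m --> \oo] --> +oo) ->
     prob (random_hypergraph k (p m))
       [pred E : {set {set 'I_#|V m|}} | copies (G m) E != set0]
       @[m --> \oo] --> (1 : R)).
Proof.
split.
  exists (copy_spread_const k Delta C'); split; first exact: copy_spread_const_gt0.
  move=> eps; have [n0 [L H]] := copies_spread Delta eps hk hd halpha hC'.
  exists n0 => n n0n V W G HH Vn _ uG _ degG mdG epsd mu.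
  have [l [r [mu' [/andP[l0 _] r0 r1 rl spr]]]] :=
    H n n0n V W G HH Vn uG degG mdG epsd mu.
  by exists l, r, mu'.
move=> eps V G p Vinf GP pinf.
have [n0 [K H]] := prob_random_hypergraph_copy Delta eps hk hd halpha.
apply/cvgrPdist_lt => e e0.
move/cvgnyPge : Vinf => /(_ n0) Vinf.
move/cvgryPgt : pinf => pinf.
near=> m.
have nm : (n0 <= #|V m|)%N by near: m.
have pm0 : 0 < p m * #|V m|%:R `^ d^-1 by near: m; exact: pinf.
(* This makes the error term smaller than [e]. *)
have pmK : K / e < p m * #|V m|%:R `^ d^-1 by near: m; exact: pinf.
have [uG degG mdG /andP[p0 p1]] := GP m.
have y0 : 0 <= #|V m|%:R `^ d^-1 by apply: powR_ge0.
have pm : 0 < p m.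
  rewrite lt0r p0 andbT; apply: contraTneq pm0 => ->.
  by rewrite mul0r ltxx.
have /andP[lo hi] := H (V m) (G m) (p m) nm uG degG mdG (introT andP (conj pm p1)).
rewrite ger0_norm ?subr_ge0 //.
apply: le_lt_trans (_ : K / (p m * #|V m|%:R `^ d^-1) < e).
  by rewrite lerBlDr -lerBlDl.
by rewrite ltr_pdivrMr // mulrC -ltr_pdivrMr.
Unshelve. all: by end_near.
Qed.
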